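(* Let $T$ be a set, let $\ell^\infty(T)$ be the space of bounded functions $z: T\to\mathbb{R}$ with the uniform norm $\|z\|=\sup_{t\in T}|z(t)|$, and let $\mathbb{B}\subset \ell^\infty(T)$ be a complete separable linear subspace equipped with the uniform norm. Let $W$ be a Borel measurable zero-mean Gaussian random element in $\mathbb{B}$, write $W_t=\pi_t(W)$ where $\pi_t:\mathbb{B}\to\mathbb{R}$, $\pi_t(b)=b(t)$, is the coordinate projection, and let $K(s,t)=\mathrm{E}W_sW_t$. Then the Banach space RKHS of $W$ (as a random element in $\mathbb{B}$) and the stochastic process RKHS of $(W_t: t\in T)$ coincide (as Hilbert spaces of functions on $T$). Furthermore, $S\pi_t=K(t,\cdot)$ for every $t\in T$.
   Context: All vector spaces are real. A Borel measurable random element $W$ in a separable Banach space $(\mathbb{B},\|\cdot\|)$, defined on a probability space $(\Omega,\mathcal{U},\mathrm{P})$, is zero-mean Gaussian if $b^*(W)$ is a (possibly degenerate) normal variable with mean zero for every $b^*$ in the dual space $\mathbb{B}^*$. Then $\mathrm{E}\|W\|^2<\infty$. Banach space RKHS: for $b^*\in\mathbb{B}^*$ let $Sb^*\in\mathbb{B}$ be the Pettis integral $\mathrm{E}Wb^*(W)$, i.e. the unique element of $\mathbb{B}$ with $b_2^*(Sb^* )=\mathrm{E}b_2^*(W)b^*(W)$ for every $b_2^*\in\mathbb{B}^*$. The Banach space RKHS $\mathbb{H}$ is the completion of $S\mathbb{B}^*=\{Sb^*: b^*\in\mathbb{B}^*\}$ under the inner product $\langle Sb_1^*,Sb_2^*\rangle_{\mathbb{H}}=\mathrm{E}b_1^*(W)b_2^*(W)$.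 Because $\|Sb^*\|\le\sigma(W)\|Sb^*\|_{\mathbb{H}}$ with $\sigma^2(W)=\sup_{\|b^*\|=1}\mathrm{E}b^*(W)^2<\infty$, this completion is identified with a subset of $\mathbb{B}$ (an $\mathbb{H}$-Cauchy sequence in $S\mathbb{B}^*$ is identified with its limit in $\mathbb{B}$). Stochastic process RKHS: for a zero-mean Gaussian process $(W_t:t\in T)$ with covariance function $K(s,t)=\mathrm{E}W_sW_t$ it is the completion of the linear span of the functions $K(s,\cdot)$, $s\in T$, under the inner product $\langle\sum_i\alpha_iK(s_i,\cdot),\sum_j\beta_jK(t_j,\cdot)\rangle_{\mathbb{H}}=\sum_i\sum_j\alpha_i\beta_jK(s_i,t_j)$; it is identified with a space of functions on $T$ through the reproducing formula $f(t)=\langle f,K(t,\cdot)\rangle_{\mathbb{H}}$. *)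

(* Defs.v *)
From HB Require Import structures.
From mathcomp Require Import all_boot all_order all_algebra.
From mathcomp Require Import all_classical all_reals all_analysis.

Set Implicit Arguments.
Unset Strict Implicit.
Unset Printing Implicit Defensive.

Import Order.TTheory GRing.Theory Num.Theory.
Import numFieldNormedType.Exports.

Local Open Scope classical_set_scope.
Local Open Scope ring_scope.

Section linfty.
Variables (R : realType) (T : Type).

Definition bounded_pred : {pred (T -> R^o)} :=
  fun z => `[< bounded_fun z >].

Lemma bounded_predP (z : T -> R^o) :
  reflect (exists M : R, forall t, `|z t| <= M) (z \in bounded_pred).
Proof.
apply: (iffP (asboolP _)) => [[M [_ hM]]|[M hM]].
  by exists (M + 1) => t; apply: hM => //; rewrite ltrDl.
exists M; split; first exact: num_real.
by move=> x /ltW Mx t _; apply: le_trans Mx.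
Qed.

Lemma bounded_pred_submod : submod_closed bounded_pred.
Proof.
split; first by apply/bounded_predP; exists 0 => t; rewrite normr0.
move=> a u v /bounded_predP[M hM] /bounded_predP[N hN].
apply/bounded_predP; exists (`|a| * M + N) => t.
apply: (le_trans (ler_normD _ _)); apply: lerD; last exact: hN.
by rewrite normrM ler_wpM2l.
Qed.

HB.instance Definition _ :=
  GRing.isSubmodClosed.Build R (T -> R^o) bounded_pred bounded_pred_submod.

Record linfty := Linfty {
  linfty_fun :> T -> R^o ;
  linfty_bounded : linfty_fun \in bounded_pred }.

HB.instance Definition _ := [isSub of linfty for linfty_fun].
HB.instance Definition _ := [Choice of linfty by <:].
HB.instance Definition _ := [SubChoice_isSubLmodule of linfty by <:].

Definition sup_norm (z : linfty) : R := sup (range (fun t => `|z t|)).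

Lemma le_sup_norm (z : linfty) t : `|z t| <= sup_norm z.
Proof.
have /bounded_predP[M hM] := linfty_bounded z.
by apply: ub_le_sup; [exists M => _ [s _ <-]; exact: hM | exists t].
Qed.

Lemma sup_norm_le (z : linfty) M :
  0 <= M -> (forall t, `|z t| <= M) -> sup_norm z <= M.
Proof.
rewrite /sup_norm => M0 hM.
have [->|/set0P ne] := eqVneq (range (fun t => `|z t|)) set0; first by rewrite sup0.
by apply: ge_sup => // _ [t _ <-]; exact: hM.
Qed.

Lemma sup_norm_ge0 (z : linfty) : 0 <= sup_norm z.
Proof.
have [z0|/set0P[x [t _ _]]] := eqVneq (range (fun t => `|z t|)) set0.
  by rewrite /sup_norm z0 sup0.
exact: le_trans (normr_ge0 _) (le_sup_norm z t).
Qed.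

Lemma sup_normD (x y : linfty) : sup_norm (x + y) <= sup_norm x + sup_norm y.
Proof.
apply: sup_norm_le => [|t]; first by rewrite addr_ge0 ?sup_norm_ge0.
by apply: (le_trans (ler_normD _ _)); apply: lerD; exact: le_sup_norm.
Qed.

Lemma sup_normZ (a : R) (x : linfty) : sup_norm (a *: x) = `|a| * sup_norm x.
Proof.
have le1 b y : sup_norm (b *: y) <= `|b| * sup_norm y.
  apply: sup_norm_le => [|t]; first by rewrite mulr_ge0 ?sup_norm_ge0.
  by rewrite normrM ler_wpM2l// le_sup_norm.
apply/eqP; rewrite eq_le le1/=; have [->|a0] := eqVneq a 0.
  by rewrite normr0 mul0r sup_norm_ge0.
rewrite -ler_pdivlMl ?normr_gt0// -normfV.
by rewrite -[in leLHS](scalerK a0 x) le1.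
Qed.

Lemma sup_norm0_eq0 (x : linfty) : sup_norm x = 0 -> x = 0.
Proof.
move=> x0; apply/val_inj/funext => t /=; apply/eqP.
by rewrite -normr_le0 -x0 le_sup_norm.
Qed.

HB.instance Definition _ :=
  Lmodule_isNormed.Build R linfty sup_normD sup_normZ sup_norm0_eq0.

End linfty.

Section subspace.
Variables (R : realType) (V : normedModType R) (S : submodClosed V).

Record subnormed := Subnormed {
  subnormed_val :> V ;
  subnormedP : subnormed_val \in S }.

HB.instance Definition _ := [isSub of subnormed for subnormed_val].
HB.instance Definition _ := [Choice of subnormed by <:].
HB.instance Definition _ := [SubChoice_isSubLmodule of subnormed by <:].

Definition subnormed_norm (x : subnormed) : R := `|subnormed_val x|.

Lemma subnormed_normD x y :
  subnormed_norm (x + y) <= subnormed_norm x + subnormed_norm y.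
Proof. exact: ler_normD. Qed.

Lemma subnormed_normZ (a : R) x :
  subnormed_norm (a *: x) = `|a| * subnormed_norm x.
Proof. exact: normrZ. Qed.

Lemma subnormed_norm0_eq0 x : subnormed_norm x = 0 -> x = 0.
Proof. by move/normr0_eq0 => x0; exact: val_inj. Qed.

HB.instance Definition _ := Lmodule_isNormed.Build R subnormed
  subnormed_normD subnormed_normZ subnormed_norm0_eq0.

End subspace.

Definition is_complete (V : puniformType) : Prop :=
  forall F : set_system V, ProperFilter F -> cauchy F -> cvg F.

Definition is_separable (V : topologicalType) : Prop :=
  exists2 D : set V, countable D & dense D.

Definition borel (V : ptopologicalType) := g_sigma_algebraType (@open V).
HB.instance Definition _ (V : ptopologicalType) := Measurable.on (borel V).

Record dual_space (R : realType) (V : normedModType R) := Dual {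
  dual_fun :> {linear V -> R^o} ;
  dual_continuous : continuous dual_fun }.

Section coordinate.
Variables (R : realType) (T : Type) (B : submodClosed (linfty R T)).

Definition to_fun (b : subnormed B) : T -> R^o := linfty_fun (subnormed_val b).

Variable t : T.

Definition coord_fun (b : subnormed B) : R^o := to_fun b t.

Lemma coord_fun_linear : linear coord_fun. Proof. by []. Qed.

HB.instance Definition _ :=
  GRing.isLinear.Build R (subnormed B) R^o _ coord_fun coord_fun_linear.

Lemma coord_fun_continuous : continuous coord_fun.
Proof.
apply: bounded_linear_continuous; rewrite -bounded_funP => r.
by exists r => b; apply: le_trans; exact: le_sup_norm.
Qed.

Definition coord_proj : dual_space (subnormed B) :=
  @Dual R (subnormed B) coord_fun coord_fun_continuous.

End coordinate.

Section completion.
Variables (R : realType) (E : lmodType R).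
(* The inner product space is the subspace [D] of [E] with inner product [dot]
   (values of [dot] outside [D] are irrelevant); [ident u h] says that a Cauchy
   sequence [u] in [D] is identified with the element [h] of [E]. *)
Variables (D : set E) (dot : E -> E -> R) (ident : (nat -> E) -> E -> Prop).

Definition dot_norm (x : E) : R := Num.sqrt (dot x x).

Definition dot_cauchy (u : nat -> E) : Prop :=
  forall e : R, 0 < e -> \forall m & n \near \oo, dot_norm (u m - u n) < e.

Definition represents (u : nat -> E) (h : E) : Prop :=
  [/\ forall n, D (u n), dot_cauchy u & ident u h].

Definition completion : set E := [set h | exists u, represents u h].

(* The inner product extended by continuity; the limit exists and does not
   depend on the representatives as soon as [ident] separates the completion
   of [D]. *)
Definition completion_dot (h g : E) : R :=
  xget 0 [set r : R | exists u v, [/\ represents u h, represents v g &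
    dot (u n) (v n) @[n --> \oo] --> r]].

End completion.

Section banach_rkhs.
Context {d : measure_display} {Omega : measurableType d} {R : realType}.
Variables (P : probability Omega R) (V : normedModType R).
Variable W : {RV P >-> borel V}.

(* the library's [normal_prob 0 0] is not the Dirac mass at 0, hence the
   separate degenerate case *)
Definition centered_normal (X : Omega -> R) : Prop :=
  (forall A : set R, measurable A -> pushforward P X A = \d_(0 : R) A) \/
  (exists2 s : R, 0 < s & forall A : set R, measurable A ->
     pushforward P X A = normal_prob 0 s A).

Definition gaussian0 : Prop :=
  forall f : dual_space V, centered_normal (fun w => f (W w)).

Definition is_pettis (f : dual_space V) (x : V) : Prop :=
  forall g : dual_space V, ('E_P[fun w => (g (W w) * f (W w))%R] = (g x)%:E)%E.

(* The Pettis integral E W f(W); the default value 0 is only used when it does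
   not exist, which does not happen for a Gaussian [W] in a Banach space. *)
Definition pettis (f : dual_space V) : V := xget 0 [set x | is_pettis f x].

(* <Sf, Sg>_H = E f(W) g(W) *)
Definition pettis_dot (x y : V) : R :=
  xget 0 [set r : R | exists f g : dual_space V, [/\ pettis f = x, pettis g = y &
    ('E_P[fun w => (f (W w) * g (W w))%R] = r%:E)%E]].

Definition banach_rkhs : set V :=
  completion (range pettis) pettis_dot (fun u h => u @ \oo --> h).

Definition banach_rkhs_dot : V -> V -> R :=
  completion_dot (range pettis) pettis_dot (fun u h => u @ \oo --> h).

End banach_rkhs.

Section process_rkhs.
Context {d : measure_display} {Omega : measurableType d} {R : realType}.
Variables (P : probability Omega R) (T : Type) (X : T -> Omega -> R).

Definition covK (s t : T) : R^o := fine 'E_P[fun w => (X s w * X t w)%R]%E.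

Definition kernel_comb (n : nat) (a : 'I_n -> R) (s : 'I_n -> T) : T -> R^o :=
  fun t => \sum_(i < n) a i * covK (s i) t.

Definition kernel_span : set (T -> R^o) :=
  [set f | exists n (a : 'I_n -> R) (s : 'I_n -> T), f = kernel_comb a s].

Definition kernel_dot (f g : T -> R^o) : R :=
  xget 0 [set r : R | exists m (a : 'I_m -> R) (s : 'I_m -> T)
                             n (b : 'I_n -> R) (t : 'I_n -> T),
    [/\ f = kernel_comb a s, g = kernel_comb b t &
        r = \sum_(i < m) \sum_(j < n) a i * b j * covK (s i) (t j)]].

(* the reproducing formula f(t) = <f, K(t, .)>, the inner product with the
   limit of the Cauchy sequence [u] being the limit of the inner products *)
Definition reproduces (u : nat -> T -> R^o) (f : T -> R^o) : Prop :=
  forall t, kernel_dot (u n) (covK t) @[n --> \oo] --> (f t : R).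

Definition process_rkhs : set (T -> R^o) :=
  completion kernel_span kernel_dot reproduces.

Definition process_rkhs_dot : (T -> R^o) -> (T -> R^o) -> R :=
  completion_dot kernel_span kernel_dot reproduces.

End process_rkhs.

(* Main.v *)
(* Write [S X] for the Pettis integral [E (W X)] of a square integrable [X].

   Existence of [S X]. A centered normal variable has a standard deviation
   bounded by a multiple of any of its quantiles, so a quantile of [|W|] bounds
   [E f(W)^2] uniformly over functionals [f] of norm at most 1. Together with
   separability this makes [W] approximable by random elements with finitely
   many values, uniformly in [f], and completeness yields [S X]; neither
   Fernique's theorem nor a Bochner integral is needed.

   Equality of the two spaces. [S W_t = K(t, .)], so the process RKHS is the
   completion of the span of the [W_t] and the Banach space RKHS that of all the
   [f(W)], both for the [L^2] inner product. It remains to see that the [W_t]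
   have dense span in the [f(W)]. If [Z_n] are the residuals of almost optimal
   approximations of [f(W)], then [S Z_n] converges to some [v] in the Banach
   space with [v(t) = lim E W_t Z_n = 0] for all [t]; hence [v = 0],
   [E f(W) Z_n] tends to [f v = 0], and so does [E Z_n^2]. *)

Require Import Defs.
From HB Require Import structures.
From mathcomp Require Import all_boot all_order all_algebra.
From mathcomp Require Import all_classical all_reals all_analysis.
From mathcomp Require Import measurable_realfun.
From mathcomp Require Import ring lra.

Set Implicit Arguments.
Unset Strict Implicit.
Unset Printing Implicit Defensive.

Import Order.TTheory GRing.Theory Num.Theory.
Import numFieldNormedType.Exports.

Local Open Scope classical_set_scope.
Local Open Scope ring_scope.

(** * Almost optimal approximation in a semi-inner product space *)

Section semi_inner_product.
Variables (R : realType) (E : lmodType R) (L : set E) (ip : E -> E -> R).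
Hypothesis L_lin : forall (a : R) x y, L x -> L y -> L (a *: x + y).
Hypothesis ipC : forall x y, ip x y = ip y x.
Hypothesis ip_lin : forall (a : R) x y z, L x -> L y -> L z ->
  ip (a *: x + y) z = a * ip x z + ip y z.
Hypothesis ip_ge0 : forall x, 0 <= ip x x.

Lemma ipDZ (a : R) x y : L x -> L y ->
  ip (a *: x + y) (a *: x + y) = a ^+ 2 * ip x x + 2 * a * ip x y + ip y y.
Proof.
move=> Lx Ly; have Lxy := L_lin a Lx Ly.
by rewrite ip_lin// (ipC x) ip_lin// (ipC y (_ + _)) ip_lin// (ipC y x); ring.
Qed.

Lemma ipZ (a : R) x : L x -> ip (a *: x) (a *: x) = a ^+ 2 * ip x x.
Proof.
move=> Lx; have L0 : L 0 by have := L_lin (-1) Lx Lx; rewrite scaleN1r addNr.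
have ip0 z : L z -> ip 0 z = 0.
  by move=> Lz; have := ip_lin 1 L0 L0 Lz; rewrite scale1r addr0; lra.
by rewrite -[a *: x]addr0 ipDZ// (ipC x) !ip0// mulr0 !addr0.
Qed.

(** The quadratic [a |-> ip (a *: x + y) (a *: x + y)] is nonnegative. As [ip] is only
    semi-definite, [ip x x = 0] may hold for [x != 0] and is a case of its own. *)
Lemma ip_cauchy_schwarz x y : L x -> L y -> ip x y ^+ 2 <= ip x x * ip y y.
Proof.
move=> Lx Ly.
have key (a : R) : 0 <= a ^+ 2 * ip x x + 2 * a * ip x y + ip y y.
  by rewrite -ipDZ.
have [x0|x0] := eqVneq (ip x x) 0.
  rewrite x0 mul0r; have [->|xy0] := eqVneq (ip x y) 0; first by rewrite expr0n.
  (* With [ip x x = 0] the quadratic is affine in [a], and this [a] gives it the value [-1]. *)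
  have := key (- (ip y y + 1) / (2 * ip x y)).
  have -> : 2 * (- (ip y y + 1) / (2 * ip x y)) * ip x y = - (ip y y + 1).
    by field.
  rewrite x0; lra.
have x_gt0 : 0 < ip x x by rewrite lt_def x0 ip_ge0.
have := key (- ip x y / ip x x).
have -> : (- ip x y / ip x x) ^+ 2 * ip x x + 2 * (- ip x y / ip x x) * ip x y
  + ip y y = (ip x x * ip y y - ip x y ^+ 2) / ip x x by field.
by rewrite pmulr_lge0 ?invr_gt0// subr_ge0.
Qed.

Section near_projection.
Variables (M : set E) (x : E).
Hypothesis M0 : M 0.
Hypothesis M_lin : forall (a : R) y z, M y -> M z -> M (a *: y + z).
Hypothesis ML : M `<=` L.
Hypothesis Lx : L x.

(** A projection of [x] onto [M] may fail to exist; a minimizing sequence for the squared distance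
    replaces it. The parallelogram law makes it Cauchy, comparison with [0] bounds the residuals,
    and comparison with [y n + c *: z] makes them almost orthogonal to [M]. *)
Lemma near_projection : exists y : nat -> E, [/\ forall n, M (y n),
  forall n m, ip (y n - y m) (y n - y m) <= 2 * n.+1%:R^-1 + 2 * m.+1%:R^-1,
  forall n, ip (x - y n) (x - y n) <= ip x x + n.+1%:R^-1 &
  forall n z, M z -> ip (x - y n) z ^+ 2 <= n.+1%:R^-1 * (ip z z + 1)].
Proof.
have sub u v : u - v = (-1) *: v + u by rewrite scaleN1r addrC.
pose S := [set ip (x - z) (x - z) | z in M].
have Sx : S (ip x x) by exists 0 => //; rewrite subr0.
have S0 : lbound S 0 by move=> _ [z _ <-].
have hS : has_inf S by split; [exists (ip x x) | exists 0].
have infS z : M z -> inf S <= ip (x - z) (x - z).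
  by move=> Mz; apply: ge_inf => //; [exists 0 | exists z].
have ey n : exists z, M z /\ ip (x - z) (x - z) < inf S + n.+1%:R^-1.
  have n0 : 0 < n.+1%:R^-1 :> R by rewrite invr_gt0.
  by have [_ [z Mz <-] lt] := inf_adherent n0 hS; exists z.
have [y hy] := choice ey.
have My n : M (y n) by case: (hy n).
have Ly n : L (y n) by apply/ML/My.
have Lxy n : L (x - y n) by rewrite sub; exact: L_lin.
exists y; split => //.
- move=> n m.
  (* The midpoint of [y n] and [y m] lies in [M], so its squared distance to [x] is at least
     [inf S]; it is written in the shape of [M_lin]. *)
  have Mh : M (2^-1 *: (1 *: y n + y m) + 0) by do 2! apply: M_lin => //.
  have := infS _ Mh; have [_ hn] := hy n; have [_ hm] := hy m.
  have -> : x - (2^-1 *: (1 *: y n + y m) + 0) =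
      2^-1 *: (1 *: (x - y n) + (x - y m)).
    have e : x = 2^-1 *: x + 2^-1 *: x.
      rewrite -scalerDl (_ : 2^-1 + 2^-1 = 1) ?scale1r//; lra.
    by rewrite addr0 !scale1r {1}e !scalerDr !scalerN opprD addrACA.
  have -> : y n - y m = (-1) *: (x - y n) + (x - y m).
    by rewrite scaleN1r opprB addrA subrK.
  rewrite ipZ; last exact: L_lin.
  rewrite !ipDZ //.
  by set a := n.+1%:R^-1 in hn *; set b := m.+1%:R^-1 in hm *; lra.
- move=> n; have [_ /ltW/le_trans] := hy n; apply.
  by rewrite lerD2r; have := infS _ M0; rewrite subr0.
move=> n z Mz; have Lz := ML Mz.
set b := ip z z; set a := ip _ z; have b0 : 0 <= b by exact: ip_ge0.
(* The minimum along the line is at [a / b]; the added 1 keeps the quotient meaningful when [b = 0]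
   and is the source of [ip z z + 1] in the bound. *)
pose c := a / (b + 1).
have Mcz : M (c *: z + y n) by exact: M_lin.
have := infS _ Mcz; have [_] := hy n.
have -> : x - (c *: z + y n) = (- c) *: z + (x - y n).
  by rewrite opprD addrCA scaleNr.
rewrite ipDZ // (ipC z) -/a -/b.
set e := n.+1%:R^-1 => h1 h2.
have h3 : 2 * c * a <= e + c ^+ 2 * b by rewrite sqrrN in h2; lra.
have ca : c * (b + 1) = a by rewrite /c divfK// gt_eqF// ltr_wpDl.
have h4 : c * a <= e.
  have c2 : 0 <= c ^+ 2 by exact: sqr_ge0.
  have ec : c * a = c ^+ 2 * b + c ^+ 2 by rewrite -ca; ring.
  lra.
have -> : a ^+ 2 = c * a * (b + 1) by rewrite expr2 -{1}ca; ring.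
by rewrite ler_wpM2r// addr_ge0.
Qed.

End near_projection.
End semi_inner_product.

(** * Second moments of centered normal variables *)

Section centered_normal_law.
Variables (R : realType) (s : R).
Hypothesis s_gt0 : 0 < s.
Notation mu := (@lebesgue_measure R).

(** The Radon-Nikodym derivative of the normal law agrees almost everywhere with [normal_pdf], both
    having the same integral over every measurable set. *)
Lemma ge0_integral_normal_prob (f : _ -> \bar R) :
  measurable_fun setT f -> (forall x, 0 <= f x)%E ->
  (\int[normal_prob 0 s]_x f x = \int[mu]_x (f x * (normal_pdf 0 s x)%:E))%E.
Proof.
move=> mf f0.
have dom := @normal_prob_dominates R 0 s.
rewrite -(Radon_Nikodym_SigmaFinite.change_of_variables dom)//.
have if' := Radon_Nikodym_SigmaFinite.f_integrable dom.
apply: ae_eq_integral => //.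
- by apply: emeasurable_funM => //; exact: measurable_int if'.
- apply: emeasurable_funM => //; apply/measurable_EFinP.
  exact: measurable_normal_pdf.
apply: ae_eqe_mul2l; apply: integral_ae_eq => //.
- exact: measurable_int (integrable_normal_pdf 0 s).
- by move=> A _ mA; rewrite -Radon_Nikodym_SigmaFinite.f_integral.
Qed.

(* [u <= exp u] with [u = x^2 / (4 s^2)] trades the factor [x^2] for a doubled
   standard deviation. *)
Lemma sqr_normal_pdf_le (x : R) :
  x ^+ 2 * normal_pdf 0 s x <= 8 * s ^+ 2 * normal_pdf 0 (s *+ 2) x.
Proof.
have s0 : s != 0 by rewrite gt_eqF.
have s20 : s *+ 2 != 0 by rewrite gt_eqF// pmulrn_lgt0.
rewrite !normal_pdfE// /normal_fun subr0. 
have -> : normal_peak (s *+ 2) = normal_peak s / 2.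
  rewrite /normal_peak -invfM; congr (_^-1).
  have -> : (s *+ 2) ^+ 2 * pi *+ 2 = (s ^+ 2 * pi *+ 2) * 2 ^+ 2 by ring.
  by rewrite sqrtrM ?sqrtr_sqr ?ger0_norm// pmulrn_lge0// mulr_ge0 ?sqr_ge0 ?pi_ge0.
set u := x ^+ 2 / (s ^+ 2 *+ 2 *+ 2).
have s2 : 0 < s ^+ 2 by rewrite exprn_gt0.
have u0 : 0 <= u by rewrite divr_ge0 ?sqr_ge0// mulrn_wge0// mulrn_wge0// ltW.
have xu : x ^+ 2 = 4 * s ^+ 2 * u by rewrite /u; field.
have -> : - x ^+ 2 / (s ^+ 2 *+ 2) = - (u *+ 2) by rewrite /u; field.
have -> : - x ^+ 2 / ((s *+ 2) ^+ 2 *+ 2) = - (u / 2) by rewrite /u; field.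
rewrite xu.
have key : u * expR (- (u *+ 2)) <= expR (- (u / 2)).
  have -> : - (u *+ 2) = - u + - u by ring.
  rewrite expRD mulrA (le_trans (_ : _ <= 1 * expR (- u)))//.
    rewrite ler_wpM2r ?expR_ge0// -(ler_pM2r (expR_gt0 u)) -mulrA -expRD addNr.
    by rewrite expR0 mulr1 mul1r (le_trans _ (expR_ge1Dx u))// lerDr.
  rewrite mul1r ler_expR; lra.
have p0 := normal_peak_ge0 s.
have := ler_wpM2l (mulr_ge0 p0 (ltW s2)) key.
lra.
Qed.


Lemma normal_prob_sqr_le : (\int[normal_prob 0 s]_x (x ^+ 2)%:E <= (8 * s ^+ 2)%:E)%E.
Proof.
have mx2 : measurable_fun setT (fun x : R => (x ^+ 2)%:E).
  by apply/measurable_EFinP; apply: measurable_funX.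
rewrite ge0_integral_normal_prob//; last by move=> x; rewrite lee_fin sqr_ge0.
have mpdf t : measurable_fun setT (EFin \o normal_pdf (0 : R) t).
  by apply/measurable_EFinP; exact: measurable_normal_pdf.
have c0 : 0 <= 8 * s ^+ 2 by rewrite mulr_ge0// sqr_ge0.
apply: (@le_trans _ _ (\int[mu]_x ((8 * s ^+ 2)%:E * (normal_pdf 0 (s *+ 2) x)%:E))%E).
  apply: ge0_le_integral => //.
  - by move=> x _; rewrite -EFinM lee_fin mulr_ge0 ?sqr_ge0 ?normal_pdf_ge0.
  - by apply: emeasurable_funM => //; exact: mpdf.
  - by apply: measurable_funeM; exact: (mpdf (s *+ 2)).
  - by move=> x _; rewrite -!EFinM lee_fin sqr_normal_pdf_le.
rewrite ge0_integralZl//; first last.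
- by move=> x _; rewrite lee_fin normal_pdf_ge0.
- exact: (mpdf (s *+ 2)).
by rewrite integral_normal_pdf mule1.
Qed.

(** The density is at most its peak, which is at most [s^-1], and the interval has length [2 * M].
    Read backwards, an interval of large mass forces [s] to be small. *)
Lemma normal_prob_itv_le (M : R) : 0 <= M ->
  (normal_prob 0 s `[(- M)%R, M] <= (2 * M / s)%:E)%E.
Proof.
move=> M0; have s0 : s != 0 by rewrite gt_eqF.
have peak_le : normal_peak s <= s^-1.
  rewrite /normal_peak lef_pV2 ?posrE ?sqrtr_gt0 ?pmulrn_lgt0 ?mulr_gt0 ?pi_gt0 ?exprn_gt0//.
  rewrite -[leLHS](ger0_norm (ltW s_gt0)) -sqrtr_sqr ler_wsqrtr//.
  rewrite -mulrnAr ler_peMr ?sqr_ge0//.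
  by have := pi_ge2 R; lra.
rewrite /normal_prob.
apply: (@le_trans _ _ (\int[mu]_(x in `[(- M)%R, M]) (s^-1)%:E)%E).
  apply: ge0_le_integral => //.
  - by move=> x _; rewrite lee_fin normal_pdf_ge0.
  - by apply: measurable_funTS; apply/measurable_EFinP; exact: measurable_normal_pdf.
  - by move=> x _; rewrite lee_fin (le_trans (normal_pdf_ub _ _ s0)).
rewrite integral_cst//= lebesgue_measure_itv/= lte_fin.
case: ifPn => _; last by rewrite mule0 lee_fin divr_ge0 ?mulr_ge0// ltW.
by rewrite -EFinD -EFinM lee_fin opprK -mulr2n -[M *+ 2]mulr_natl mulrC.
Qed.

End centered_normal_law.

Section centered_normal_moments.
Context {d : measure_display} {Omega : measurableType d} {R : realType}.
Variables (P : probability Omega R) (X : Omega -> R).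
Hypothesis mX : measurable_fun setT X.
Hypothesis normalX : centered_normal P X.

(** Both bounds are transferred from the law of [X], the first case being the Dirac mass at 0. They
    share one [s], which can then be eliminated between them. *)
Lemma centered_normal_cases : (\int[P]_w (X w ^+ 2)%:E = 0)%E \/
  (exists2 s : R, 0 < s & (\int[P]_w (X w ^+ 2)%:E <= (8 * s ^+ 2)%:E)%E /\
    forall M : R, 0 <= M -> (P [set w | (`|X w| <= M)%R] <= (2 * M / s)%:E)%E).
Proof.
have mx2 : measurable_fun setT (fun x : R => (x ^+ 2)%:E).
  by apply/measurable_EFinP; apply: measurable_funX.
have mX' : (X : Omega -> measurableTypeR R) \in mfun by apply/mem_set; exact: mX.
have intX2 : (\int[P]_w (X w ^+ 2)%:E =
    \int[distribution P (mfun_Sub mX')]_x (x ^+ 2)%:E)%E.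
  rewrite ge0_integral_pushforward//.
  by move=> x _; rewrite lee_fin sqr_ge0.
case: normalX => [X0|[s s_gt0 Xs]]; [left | right].
  rewrite intX2.
  have -> : (\int[distribution P (mfun_Sub mX')]_x (x ^+ 2)%:E =
      \int[\d_ (0%R : measurableTypeR R)]_x (x ^+ 2)%:E)%E.
    by apply: eq_measure_integral => A mA _; exact: X0.
  by rewrite integral_dirac// expr0n mule0.
exists s => //; split.
  rewrite intX2.
  have -> : (\int[distribution P (mfun_Sub mX')]_x (x ^+ 2)%:E =
      \int[normal_prob 0 s]_x (x ^+ 2)%:E)%E.
    by apply: eq_measure_integral => A mA _; exact: Xs.
  exact: normal_prob_sqr_le.
move=> M M0; rewrite (_ : [set w | _] = X @^-1` `[(- M)%R, M]).
  by have := normal_prob_itv_le s_gt0 M0; rewrite -Xs.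
by apply/seteqP; split => w /=; rewrite in_itv/= ler_norml.
Qed.

Lemma centered_normal_sqr_lty : (\int[P]_w (X w ^+ 2)%:E < +oo)%E.
Proof.
have [->//|[s s_gt0 [h _]]] := centered_normal_cases.
by rewrite (le_lt_trans h)// ltry.
Qed.

(** From [3/4 <= P(|X| <= M) <= 2 * M / s] follows [s <= 8/3 * M], and [8 * (8/3)^2 = 512/9] is
    below 64. *)
Lemma centered_normal_sqr_le (M : R) : 0 <= M ->
  (P [set w | (M < `|X w|)%R] <= (4^-1)%:E)%E ->
  (\int[P]_w (X w ^+ 2)%:E <= (64 * M ^+ 2)%:E)%E.
Proof.
move=> M0 hM; have [->|[s s_gt0 [h /(_ M M0) hs]]] := centered_normal_cases.
  by rewrite lee_fin mulr_ge0// sqr_ge0.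
apply: (le_trans h); rewrite lee_fin.
have mA : measurable [set w | M < `|X w|].
  rewrite (_ : [set w | _] = (Num.norm \o X) @^-1` `]M, +oo[).
    by rewrite -[X in measurable X]setTI; apply: (measurableT_comp _ _).
  by apply/seteqP; split => w /=; rewrite in_itv/= andbT.
have e : [set w | `|X w| <= M] = ~` [set w | M < `|X w|].
  by apply/seteqP; split => w /=; rewrite leNgt => /negP.
rewrite e probability_setC// in hs.
have : (1 - (4^-1)%:E <= (2 * M / s)%:E :> \bar R)%E.
  by apply: le_trans hs; rewrite leeB.
rewrite -EFinB lee_fin ler_pdivlMr// => hsM.
have : s <= 8 / 3 * M by lra.
move=> sM.
have : s ^+ 2 <= (8 / 3 * M) ^+ 2.
  by rewrite ler_pXn2r ?nnegrE ?(ltW s_gt0)// (le_trans _ sM)// ltW.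
by rewrite exprMn; have := sqr_ge0 M; lra.
Qed.

End centered_normal_moments.

(** * The L2 inner product *)

Section mixed_moment.
Context {d : measure_display} {Omega : measurableType d} {R : realType}.
Variable P : probability Omega R.

(** The codomain [R^o] gives these functions the module structure that the semi-inner product
    section asks for. *)
Definition square_integrable : set (Omega -> R^o) :=
  [set X | (X : Omega -> R) \in Lfun P 2%:E].

Definition mixed_moment (X Y : Omega -> R^o) : R := \int[P]_w (X w * Y w).

Local Notation L2 := square_integrable.
Local Notation ip := mixed_moment.

Lemma square_integrableP (X : Omega -> R^o) : L2 X <->
  measurable_fun setT (X : Omega -> R) /\ (\int[P]_w (X w ^+ 2)%:E < +oo)%E.
Proof.
split=> [X2|[mX X2]].
  split; first by move: X2 => /andP[/[!inE]].
  have /integrableP[_] := Lfun2_integrable_sqr X2.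
  by under eq_integral => w _ do rewrite /= ger0_norm ?sqr_ge0//.
rewrite /square_integrable /= inE; apply/andP; split; rewrite inE//=.
rewrite /finite_norm unlock poweR_lty//.
by under eq_integral => w _ do rewrite /= powR_mulrn// real_normK ?num_real//.
Qed.

Lemma square_integrable_lin (a : R) X Y : L2 X -> L2 Y -> L2 (a *: X + Y).
Proof.
have p1 : (1 <= 2%:E :> \bar R)%E by rewrite lee_fin; lra.
exact: (Lfun_submod_closed P p1).2.
Qed.

Lemma square_integrable0 : L2 0.
Proof.
have p1 : (1 <= 2%:E :> \bar R)%E by rewrite lee_fin; lra.
exact: (Lfun_submod_closed P p1).1.
Qed.

Lemma integrable_mul X Y : L2 X -> L2 Y ->
  P.-integrable setT (EFin \o (fun w => X w * Y w)).
Proof. by move=> X2 Y2; apply/Lfun1_integrable; exact: Lfun2_mul_Lfun1. Qed.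

Lemma expectation_mul X Y : L2 X -> L2 Y ->
  ('E_P[fun w => X w * Y w]%R = (ip X Y)%:E)%E.
Proof.
by move=> X2 Y2; rewrite unlock fineK// integrable_fin_num// integrable_mul.
Qed.

Lemma mixed_momentC X Y : ip X Y = ip Y X.
Proof. by apply: eq_Rintegral => w _; rewrite mulrC. Qed.

Lemma mixed_moment_lin (a : R) X Y Z : L2 X -> L2 Y -> L2 Z ->
  ip (a *: X + Y) Z = a * ip X Z + ip Y Z.
Proof.
move=> X2 Y2 Z2; rewrite -RintegralZl//; last exact: integrable_mul.
rewrite -RintegralD//; last exact: integrable_mul.
  by apply: eq_Rintegral => w _; rewrite mulrA -mulrDl.
have aX2 : L2 (a *: X).
  by rewrite -[_ *: _]addr0; apply: square_integrable_lin square_integrable0.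
by have := integrable_mul aX2 Z2; congr (_.-integrable _ _);
  apply/funext => w /=; rewrite mulrA.
Qed.

Lemma mixed_moment_ge0 X : 0 <= ip X X.
Proof. by apply: Rintegral_ge0 => w _; rewrite -expr2 sqr_ge0. Qed.

Lemma mixed_moment_sum n (a : 'I_n -> R) (X : 'I_n -> Omega -> R^o) Z :
  (forall i, L2 (X i)) -> L2 Z ->
  L2 (\sum_(i < n) a i *: X i) /\
  ip (\sum_(i < n) a i *: X i) Z = \sum_(i < n) a i * ip (X i) Z.
Proof.
move=> X2 Z2; elim: n a X X2 => [|n IHn] a X X2.
  rewrite !big_ord0; split; first exact: square_integrable0.
  by rewrite /mixed_moment; under eq_Rintegral do rewrite mul0r;
    rewrite Rintegral_cst// mul0r.
have [IH1 IH2] := IHn (a \o lift ord0) (X \o lift ord0) (fun i => X2 _).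
rewrite !big_ord_recl; split; first exact: square_integrable_lin.
by rewrite mixed_moment_lin// IH2.
Qed.

(** Dominated convergence with dominating function [X^2]: every point lies in some [F k], so the
    indicators vanish eventually. *)
Lemma square_integrable_tail X (F : nat -> set Omega) (e : R) :
  L2 X -> (forall n, measurable (F n)) -> \bigcup_n F n = setT -> 0 < e ->
  exists N, \int[P]_w (X w ^+ 2 * \1_(~` \big[setU/set0]_(k < N) F k) w) <= e.
Proof.
move=> X2 mF Fcov e_gt0.
have [mX _] := (square_integrableP X).1 X2.
pose f n w := (X w ^+ 2 * \1_(~` \big[setU/set0]_(k < n) F k) w)%:E.
have iX2 := Lfun2_integrable_sqr X2.
have mf n : measurable_fun setT (f n).
  apply/measurable_EFinP/measurable_funM; first exact: measurable_funX.
  by apply: measurable_indic; apply: measurableC; exact: bigsetU_measurable.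
have [_ _ cvg0] : [/\ P.-integrable setT (cst 0%E : Omega -> \bar R),
    [sequence \int[P]_(w in setT) `|f n w - cst 0 w|]_n @ \oo --> 0 &
    [sequence \int[P]_(w in setT) f n w]_n @ \oo --> \int[P]_(w in setT) cst 0 w]%E.
  apply: (dominated_convergence _ _ _ _ iX2) => //; apply: aeW => w.
    move=> _; have : (\bigcup_n F n) w by rewrite Fcov.
    move=> [N _ FNw]; apply: cvg_near_cst; near=> n.
    rewrite /f indicE memNset ?mulr0// => /(_ (_ : _ w)) []; rewrite -bigcup_mkord.
    by exists N => //=; near: n; exact: nbhs_infty_gt.
  move=> n _; rewrite /f /= lee_fin normrM ger0_norm ?sqr_ge0// ler_piMr ?sqr_ge0//.
  by rewrite indicE; case: (_ \in _); rewrite ?normr1 ?normr0.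
rewrite integral_cst//= mul0e in cvg0.
have /fine_cvg := cvg0 => /cvgrPdist_le/(_ _ e_gt0)[N _ /(_ N (leqnn _))] /=.
rewrite sub0r normrN => h; exists N; exact: le_trans (ler_norm _) h.
Unshelve. all: by end_near. Qed.

End mixed_moment.

(** * Pettis integrals of a Gaussian random element *)

Lemma open_norm_gt (R : realType) (V : normedModType R) (M : R) :
  open [set x : V | M < `|x|].
Proof.
apply: (@open_comp _ _ (Num.norm : V -> R) [set r | M < r]); last exact: open_gt.
by move=> x _; exact: norm_continuous.
Qed.

Section random_element.
Context {d : measure_display} {Omega : measurableType d} {R : realType}.
Variables (P : probability Omega R) (V : normedModType R).
Variable W : {RV P >-> borel V}.

Lemma measurable_preimage_open (U : set V) :
  open U -> measurable ((W : Omega -> V) @^-1` U).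
Proof.
move=> oU; have := @measurable_funPT _ _ _ _ W measurableT U.
by rewrite setTI; apply; exact: sub_sigma_algebra.
Qed.

Lemma measurable_continuous_comp (f : V -> R^o) :
  continuous f -> measurable_fun setT (fun w => f (W w) : R).
Proof.
move=> /continuousP cf.
apply: (measurability _ (RGenOInfty.measurableE R)) => _ [_ [x ->] <-]; rewrite setTI.
apply: (measurable_preimage_open (U := f @^-1` `]x, +oo[)).
by apply: cf; exact: interval_open.
Qed.

Lemma dual_bounded (f : dual_space V) :
  exists2 l : R, 0 <= l & forall x, `|f x| <= l * `|x|.
Proof.
have /linear_boundedP/pinfty_ex_gt0[l l0 fl] :=
  continuous_linear_bounded 0 (@dual_continuous _ _ f 0).
by exists l; [exact: ltW | exact: fl].
Qed.

(** The events [n < |W|] decrease to the empty set. The level 1/4 is the one required by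
    [centered_normal_sqr_le]. *)
Lemma norm_tail_small : exists2 M : R, 0 <= M &
  (P [set w | (M < `|(W w : V)|)%R] <= (4^-1)%:E)%E.
Proof.
pose F n := [set w | n%:R < `|(W w : V)|].
have mF n : measurable (F n).
  apply: (measurable_preimage_open (U := [set x : V | n%:R < `|x|])).
  exact: open_norm_gt.
have F0 : \bigcap_n F n = set0.
  apply/seteqP; split => // w /(_ (Num.truncn `|(W w : V)|).+1 I).
  by rewrite /F /= ltNge ltW// truncnS_gt.
have : P \o F @ \oo --> P (\bigcap_n F n).
  apply: nonincreasing_cvg_mu => //.
  - by rewrite (le_lt_trans (probability_le1 _ _))// ltry.
  - by rewrite F0.
  move=> m n mn; apply/subsetPset => w; rewrite /F /=; apply: le_lt_trans.
  by rewrite ler_nat.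
rewrite F0 measure0 => /fine_cvgP[fF /cvgrPdist_le].
have q0 : 0 < 4^-1 :> R by lra.
move=> /(_ _ q0) [N _ /(_ _ (leqnn N))] /=.
rewrite sub0r normrN => h; exists N%:R => //.
rewrite -/(F N) -(fineK (fin_num_measure P _ (mF N))) lee_fin.
exact: le_trans (ler_norm _) h.
Qed.

(** If [|f x| <= l * |x|], then [|f(W)| > l * M] forces [|W| > M]. Hence one quantile [M] of the
    norm serves all functionals, and [C] does not depend on [f]. *)
Lemma dual_moment_le : gaussian0 W -> exists2 C : R, 0 <= C &
  forall (f : dual_space V) (l : R), 0 <= l -> (forall x, `|f x| <= l * `|x|) ->
    square_integrable P (f \o W) /\
    mixed_moment P (f \o W) (f \o W) <= C * l ^+ 2.
Proof.
move=> gW; have [M M0 hM] := norm_tail_small.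
exists (64 * M ^+ 2) => [|f l l0 fl]; first by rewrite mulr_ge0// sqr_ge0.
have mf : measurable_fun setT (f \o W : Omega -> R).
  exact/measurable_continuous_comp/dual_continuous.
have hf : (P [set w | (l * M < `|(f \o W) w : R|)%R] <= (4^-1)%:E)%E.
  apply: le_trans hM; apply: le_measure; rewrite ?inE.
  - rewrite (_ : [set w | _] = (Num.norm \o (f \o W)) @^-1` `]l * M, +oo[).
      by rewrite -[X in measurable X]setTI; apply: (measurableT_comp _ _).
    by apply/seteqP; split => w /=; rewrite in_itv/= andbT.
  - apply: (measurable_preimage_open (U := [set x : V | M < `|x|])).
    exact: open_norm_gt.
  move=> w /=; apply: contraTT; rewrite -!leNgt => WM.
  exact: le_trans (fl _) (ler_wpM2l l0 WM).
have f2 : square_integrable P (f \o W).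
  by apply/square_integrableP; split => //; exact: centered_normal_sqr_lty (gW f).
split => //; have := centered_normal_sqr_le mf (gW f) (mulr_ge0 l0 M0) hf.
rewrite -lee_fin -expectation_mul// unlock.
by rewrite exprMn mulrCA mulrC.
Qed.

Lemma square_integrable_dual (f : dual_space V) :
  gaussian0 W -> square_integrable P (f \o W).
Proof.
move=> /dual_moment_le[C _ hC]; have [l l0 fl] := dual_bounded f.
by have [] := hC f l l0 fl.
Qed.

End random_element.

Lemma dense_sequence (R : realType) (V : normedModType R) : is_separable V ->
  exists x : nat -> V, forall (e : R) (v : V), 0 < e -> exists k, `|v - x k| < e.
Proof.
move=> [D cD dD].
have ball_D (e : R) (v : V) : 0 < e -> exists2 y, D y & `|v - y| < e.
  move=> e0; have := dD (ball v e) _ (ball_open _ _).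
  case; first by exists v; exact: ballxx.
  by move=> y [vy Dy]; exists y => //; move: vy; rewrite -ball_normE.
(* A countable set is empty or the image of a sequence; density excludes the former. *)
have /pfcard_geP[D0|[f]] := cD.
  by have [y] := ball_D 1 0 ltr01; rewrite D0.
exists f => e v /(ball_D _ v) [y Dy vy].
by have [k _ fk] := 'surj_f Dy; exists k; rewrite fk.
Qed.

(** * Approximation of Pettis integrals by finitely valued random elements *)

Section finite_rank_approximation.
Context {d : measure_display} {Omega : measurableType d} {R : realType}.
Variables (P : probability Omega R) (V : normedModType R).
Variable W : {RV P >-> borel V}.
Hypotheses (Vseparable : is_separable V) (Wgauss : gaussian0 W).

(* Freezing [W] at the centers of finitely many small balls changes the moment
   [E f(W) X] by a quantity controlled by the norm of [f] only. *)
Lemma pettis_approximation (X : Omega -> R^o) : square_integrable P X ->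
  exists K : R -> R, forall e : R, 0 < e -> exists x : V,
    forall (f : dual_space V) (l : R), 0 <= l -> (forall y, `|f y| <= l * `|y|) ->
    `|f x - mixed_moment P (f \o W) X| <= e * K l.
Proof.
move=> X2; have [C C0 hC] := dual_moment_le Wgauss.
have [x hx] := dense_sequence Vseparable.
have [mX _] := (square_integrableP P X).1 X2.
have X1 : P.-integrable setT (EFin \o (fun w => `|X w|)).
  apply: integrable_norm; apply/Lfun1_integrable.
  by apply: (@Lfun_subset12 _ _ _ P); rewrite ?fin_num_measure.
have absX0 : 0 <= \int[P]_w `|X w| by apply: Rintegral_ge0.
(* The first term comes from the radius [e] of the balls, the other two from the part of [Omega]
   that the chosen balls leave uncovered. *)
exists (fun l => l * \int[P]_w `|X w| + (C * l ^+ 2 + 1) / 2) => e e0.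
pose F k := (W : Omega -> V) @^-1` ball (x k) e.
have mF k : measurable (F k).
  by apply: measurable_preimage_open; exact: ball_open.
have Fcov : \bigcup_k F k = setT.
  apply/seteqP; split => // w _; have [k hk] := hx e (W w) e0.
  by exists k => //; rewrite /F /= -ball_normE /= distrC.
have e2 : 0 < e ^+ 2 by rewrite exprn_gt0.
have [N hN] := square_integrable_tail X2 mF Fcov e2.
pose A := seqDU F.
have mA k : measurable (A k) by exact: seqDU_measurable.
pose U := \big[setU/set0]_(k < N) F k.
have mU : measurable U by exact: bigsetU_measurable.
pose Y k := \1_(A k) : Omega -> R^o.
have Y2 k : square_integrable P (Y k).
  apply/square_integrableP; split; first exact: measurable_indic.
  have -> : (fun w => (Y k w ^+ 2)%:E) = (fun w => (\1_(A k) w)%:E).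
    by apply/funext => w; rewrite /Y indicE; case: (_ \in _); rewrite ?expr1n ?expr0n.
  by rewrite integral_indic// setIT (le_lt_trans (probability_le1 _ _))// ltry.
(* This is [E (W' X)], where [W'] equals [x k] on the disjoint pieces [A k], [k < N], and 0
   elsewhere; [h] below is [f(W')]. *)
exists (\sum_(k < N) mixed_moment P (Y k) X *: x k) => f l l0 fl.
have [f2 fC] := hC f l l0 fl.
have [h2 hX] := mixed_moment_sum (fun k : 'I_N => f (x k)) (fun k => Y2 k) X2.
set h := (\sum_(i < N) _) in h2 hX.
have -> : f (\sum_(k < N) mixed_moment P (Y k) X *: x k) = mixed_moment P h X.
  rewrite hX linear_sum; apply: eq_bigr => k _.
  by rewrite linearZ /= mulrC.
have hE w : h w = \sum_(k < N) f (x k) * \1_(A k) w.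
  by rewrite /h; elim/big_rec2: _ => // k y1 y2 _ <-.
(* On [U] exactly one piece contains [w] and its center is within [e] of [W w]; outside [U] all
   terms of [h] vanish. *)
have near_h w : `|h w - f (W w)| <= l * e + `|f (W w)| * \1_(~` U) w.
  rewrite hE; have [wU|wU] := boolP (w \in U).
    have : (\big[setU/set0]_(k < N) A k) w.
      by rewrite /A -bigsetU_seqDU; move: wU; rewrite inE.
    rewrite -bigcup_mkord => -[k /= kN Akw].
    rewrite (bigD1 (Ordinal kN))//= big1 => [|j /eqP jk]; last first.
      rewrite indicE memNset ?mulr0// => Ajw; apply: jk; apply/val_inj => /=.
      by apply: (@trivIset_seqDU _ F) => //; exists w.
    rewrite addr0 indicE mem_set// mulr1 -linearB (le_trans (fl _))//.
    rewrite indicE memNset ?mulr0 ?addr0; last by apply; rewrite -in_setE.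
    rewrite ler_wpM2l//; have := subset_seqDU Akw.
    by rewrite /F /= -ball_normE => /ltW.
  have notU k : (k < N)%N -> ~ A k w.
    move=> kN Akw; move/negP: wU; apply; rewrite inE /U bigsetU_seqDU.
    by rewrite -bigcup_mkord; exists k.
  rewrite big1 => [|j _]; last by rewrite indicE memNset ?mulr0//; exact: notU.
  rewrite sub0r normrN indicE mem_set ?mulr1 ?lerDr ?mulr_ge0// ?ltW//.
  by move=> Uw; move/negP: wU; apply; rewrite inE.
have -> : mixed_moment P h X - mixed_moment P (f \o W) X =
    \int[P]_w ((h w - f (W w)) * X w).
  rewrite -RintegralB//; try exact: integrable_mul.
  by apply: eq_Rintegral => w _; rewrite mulrBl.
have D2 : square_integrable P (h - (f \o W) : Omega -> R^o).
  by rewrite -scaleN1r addrC; exact: square_integrable_lin.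
have D1 := integrable_mul D2 X2.
apply: (le_trans (le_normr_Rintegral _ D1)) => //.
have iX2 : P.-integrable setT (EFin \o (fun w => X w ^+ 2)).
  exact: Lfun2_integrable_sqr.
have if2 : P.-integrable setT (EFin \o (fun w => f (W w) ^+ 2 : R)).
  exact: (@Lfun2_integrable_sqr _ _ _ P (f \o W : Omega -> R)).
have iXU : P.-integrable setT (EFin \o (fun w => X w ^+ 2 * \1_(~` U) w)).
  apply: le_integrable iX2 => //.
    apply/measurable_EFinP/measurable_funM; first exact: measurable_funX.
    by apply: measurable_indic; exact: measurableC.
  move=> w _ /=; rewrite lee_fin normrM ler_piMr//.
  by rewrite indicE; case: (_ \in _); rewrite ?normr1 ?normr0.
have iZ (c : R) (Z : Omega -> R) : P.-integrable setT (EFin \o Z) ->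
    P.-integrable setT (EFin \o (fun w => c * Z w)).
  by move=> iZ; have := integrableZl measurableT c iZ.
have i1 := iZ (l * e) _ X1.
have i2 := iZ (e / 2) _ if2.
have i3 := iZ (2 * e)^-1 _ iXU.
have i12 : P.-integrable setT (EFin \o (fun w => l * e * `|X w| + e / 2 * f (W w) ^+ 2)).
  by have := integrableD measurableT i1 i2.
(* Young's inequality splits [|f(W)| |X|] outside [U]; with the weight [(2 * e)^-1] the tail bound
   [e ^+ 2] becomes [e / 2]. *)
apply: (@le_trans _ _ (\int[P]_w (l * e * `|X w| + e / 2 * f (W w) ^+ 2 +
    (2 * e)^-1 * (X w ^+ 2 * \1_(~` U) w)))).
  apply: le_Rintegral => //.
  - exact: integrable_norm.
  - by have := integrableD measurableT i12 i3.
  move=> w _ /=; rewrite normrM.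
  apply: (le_trans (ler_wpM2r (normr_ge0 _) (near_h w))).
  rewrite mulrDl -addrA lerD2l.
  set a := f (W w) : R; set b := X w : R.
  have [wU|wU] := boolP (w \in ~` U); rewrite indicE ?wU ?(negbTE wU); last first.
    by rewrite !mulr0 mul0r addr0 mulr_ge0 ?sqr_ge0// divr_ge0// ltW.
  rewrite !mulr1 -(real_normK (num_real a)) -(real_normK (num_real b)).
  rewrite -subr_ge0.
  have -> : e / 2 * `|a| ^+ 2 + (2 * e)^-1 * `|b| ^+ 2 - `|a| * `|b| =
      (2 * e)^-1 * (e * `|a| - `|b|) ^+ 2 by field; rewrite gt_eqF.
  by rewrite mulr_ge0 ?sqr_ge0// invr_ge0 mulr_ge0// ltW.
rewrite RintegralD// RintegralD// !RintegralZl//.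
have ff : \int[P]_w (f (W w) ^+ 2) <= C * l ^+ 2 by [].
have : e / 2 * \int[P]_w (f (W w) ^+ 2) <= e / 2 * (C * l ^+ 2).
  by rewrite ler_wpM2l// divr_ge0// ltW.
have : (2 * e)^-1 * \int[P]_w (X w ^+ 2 * \1_(~` U) w) <= e / 2.
  rewrite ler_pdivrMl ?mulr_gt0//.
  have -> : 2 * e * (e / 2) = e ^+ 2 by field.
  exact: hN.
lra.
Qed.

End finite_rank_approximation.

(** * Existence of the Pettis integral in a complete separable space of bounded functions *)

Section pettis_existence.
Variables (R : realType) (T : Type) (B : submodClosed (linfty R T)).
Local Notation V := (subnormed B).
Hypotheses (Vcomplete : is_complete V) (Vseparable : is_separable V).

Lemma le_norm_coord (x : V) t : `|coord_proj B t x| <= `|x|.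
Proof. exact: le_sup_norm. Qed.

Lemma norm_le_coord (x : V) (M : R) :
  0 <= M -> (forall t, `|coord_proj B t x| <= M) -> `|x| <= M.
Proof. exact: sup_norm_le. Qed.

Lemma coord_inj (x y : V) :
  (forall t, coord_proj B t x = coord_proj B t y) -> x = y.
Proof. by move=> xy; do 2! apply: val_inj; exact/funext. Qed.

Lemma complete_sequence (u : nat -> V) :
  (forall e : R, 0 < e -> \forall m & n \near \oo, `|u m - u n| < e) ->
  exists x : V, u @ \oo --> x.
Proof.
move=> cu; suff : cauchy (u @ \oo) by move/Vcomplete => h; exists (lim (u @ \oo)).
apply/cauchy_ballP => e e0; rewrite near_map2.
by apply: filterS (cu e e0) => -[m n] /=; rewrite -ball_normE.
Qed.

Context {d : measure_display} {Omega : measurableType d}.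
Variables (P : probability Omega R) (W : {RV P >-> borel V}).
Hypothesis Wgauss : gaussian0 W.

(* [pettis W f] is convertible to [pettis_mean (f \o W)]. *)
Definition is_pettis_mean (X : Omega -> R^o) (x : V) : Prop :=
  forall g : dual_space V, ('E_P[fun w => (g (W w) * X w)%R] = (g x)%:E)%E.

Definition pettis_mean (X : Omega -> R^o) : V := xget 0 [set x | is_pettis_mean X x].

Local Notation ip := (mixed_moment P).

(** The approximations with error of order [n.+1%:R^-1] are uniform over the coordinate projections,
    all bounded by the norm, hence Cauchy for the uniform norm. Their limit has the right value
    under each continuous [g], so the default value of [xget] is not taken. *)
Lemma pettis_meanP (X : Omega -> R^o) (g : dual_space V) :
  square_integrable P X -> g (pettis_mean X) = ip (g \o W) X.
Proof.
move=> X2.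
suff [x hx] : exists x, forall g : dual_space V, g x = ip (g \o W) X.
  have xm : is_pettis_mean X x.
    move=> f; rewrite (expectation_mul (X := f \o W)) ?hx//.
    exact: square_integrable_dual.
  have := @xgetPex _ 0 [set x | is_pettis_mean X x] (ex_intro _ x xm) g.
  rewrite (expectation_mul (X := g \o W))//; last exact: square_integrable_dual.
  by move=> [].
have [K hK] := pettis_approximation Vseparable Wgauss X2.
have n0 n : 0 < n.+1%:R^-1 :> R by rewrite invr_gt0.
have [x hx] := choice (fun n => hK _ (n0 n)).
have cx : forall e : R, 0 < e -> \forall m & n \near \oo, `|x m - x n| < e.
  move=> e e0.
  (* The sign of [K 1] is unknown, and a positive bound is needed for the division. *)
  have [K1 K1_gt0 hK1] : exists2 K1, 0 < K1 & K 1 <= K1.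
    by exists (`|K 1| + 1); [rewrite ltr_wpDl | rewrite (le_trans (ler_norm _))// lerDl].
  have coordx n t : `|coord_proj B t (x n) - ip (coord_proj B t \o W) X| <=
      n.+1%:R^-1 * K1.
    apply: (le_trans (hx n _ 1 _ _)) => // [y|]; first by rewrite mul1r le_norm_coord.
    by rewrite ler_wpM2l.
  have eK : 0 < e / (3 * K1) by rewrite divr_gt0 ?mulr_gt0.
  near=> m n.
  have small k : k.+1%:R^-1 < e / (3 * K1) -> k.+1%:R^-1 * K1 < e / 3.
    move=> hk; have := ltr_pM2r K1_gt0 => /(_ k.+1%:R^-1 (e / (3 * K1))).
    rewrite hk => h; apply: (lt_le_trans h).
    by rewrite le_eqVlt; apply/orP; left; apply/eqP; field; rewrite gt_eqF.
  have hm : m.+1%:R^-1 * K1 < e / 3.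
    by apply: small; near: m; exact: near_infty_natSinv_lt (PosNum eK).
  have hn : n.+1%:R^-1 * K1 < e / 3.
    by apply: small; near: n; exact: near_infty_natSinv_lt (PosNum eK).
  apply: (@le_lt_trans _ _ (e / 3 + e / 3)); last lra.
  apply: norm_le_coord => [|t]; first lra.
  rewrite linearB /=.
  apply: (le_trans (ler_distD (ip (coord_proj B t \o W) X) _ _)); apply: lerD.
    by rewrite (le_trans (coordx m t))// ltW.
  by rewrite distrC (le_trans (coordx n t))// ltW.
have [y hy] := complete_sequence cx.
exists y => g'; have [l l0 gl] := dual_bounded g'.
have c1 : g' (x n) @[n --> \oo] --> g' y.
  exact: (continuous_cvg _ (@dual_continuous _ _ g' y) hy).
have c2 : (g' (x n) : R) @[n --> \oo] --> ip (g' \o W) X.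
  apply/cvgrPdist_le => e e0.
  have eK : 0 < e / (`|K l| + 1) by rewrite divr_gt0// ltr_wpDl.
  near=> n; rewrite distrC (le_trans (hx n g' l l0 gl))//.
  rewrite (@le_trans _ _ (n.+1%:R^-1 * (`|K l| + 1)))//.
    by rewrite ler_wpM2l// (le_trans (ler_norm _))// lerDl.
  rewrite -ler_pdivlMr ?ltr_wpDl// ltW//; near: n.
  exact: near_infty_natSinv_lt (PosNum eK).
exact: (cvg_unique _ c1 c2).
Unshelve. all: by end_near. Qed.

End pettis_existence.

(** * Density of the coordinate variables *)

Section dual_combination.
Variables (R : realType) (V : normedModType R).
Variables (a : R) (f g : dual_space V).

(** [dual_space] carries no module structure; this combination is what makes the variables [f(W)] a
    linear set. *)
Definition dual_comb_fun (x : V) : R^o := a *: f x + g x.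

Lemma dual_comb_linear : linear dual_comb_fun.
Proof.
move=> c x y; rewrite /dual_comb_fun (linearP f) (linearP g).
by rewrite !scalerDr !scalerA [a * c]mulrC addrACA.
Qed.

HB.instance Definition _ :=
  GRing.isLinear.Build R V R^o _ dual_comb_fun dual_comb_linear.

Lemma dual_comb_continuous : continuous dual_comb_fun.
Proof.
move=> x; apply: cvgD; last exact: dual_continuous.
by apply: cvgZl_tmp; exact: dual_continuous.
Qed.

Definition dual_comb : dual_space V := @Dual R V dual_comb_fun dual_comb_continuous.

End dual_combination.

Section dual_variables.
Variables (R : realType) (T : Type) (B : submodClosed (linfty R T)).
Local Notation V := (subnormed B).
Hypotheses (Vcomplete : is_complete V) (Vseparable : is_separable V).
Context {d : measure_display} {Omega : measurableType d}.
Variables (P : probability Omega R) (W : {RV P >-> borel V}).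
Hypothesis Wgauss : gaussian0 W.

Local Notation ip := (mixed_moment P).
Local Notation S := (pettis_mean W).
Local Notation X_ t := (coord_proj B t \o W : Omega -> R^o).

(** These are functions and not classes modulo null sets, so the mixed moment is only a semi-inner
    product on them. *)
Definition dual_variables : set (Omega -> R^o) :=
  [set Y | exists f : dual_space V, Y = f \o W].

Definition coord_comb (n : nat) (a : 'I_n -> R) (s : 'I_n -> T) : Omega -> R^o :=
  \sum_(i < n) a i *: X_ (s i).

Definition coord_variables : set (Omega -> R^o) :=
  [set Y | exists n (a : 'I_n -> R) (s : 'I_n -> T), Y = coord_comb a s].

Local Notation L := dual_variables.
Local Notation M := coord_variables.

Lemma dual_variables_lin (a : R) Y Z : L Y -> L Z -> L (a *: Y + Z).
Proof. by move=> [f ->] [g ->]; exists (dual_comb a f g). Qed.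

Lemma dual_variablesB Y Z : L Y -> L Z -> L (Y - Z).
Proof. by move=> LY LZ; rewrite addrC -scaleN1r; exact: dual_variables_lin. Qed.

Lemma dual_variables_coord t : L (X_ t).
Proof. by exists (coord_proj B t). Qed.

Lemma dual_variables0 : L 0.
Proof.
have c0 : continuous (\0 : {linear V -> R^o}) by exact: (@cst_continuous V R^o 0).
exists (@Dual R V (\0 : {linear V -> R^o}) c0).
by apply/funext.
Qed.

Lemma dual_variables_sqr Y : L Y -> square_integrable P Y.
Proof. by move=> [f ->]; exact: square_integrable_dual. Qed.

Lemma coord_comb_dual n (a : 'I_n -> R) s : L (coord_comb a s).
Proof.
rewrite /coord_comb; elim/big_ind: _ => [|Y Z LY LZ|i _]; first exact: dual_variables0.
  by rewrite -[Y]scale1r; exact: dual_variables_lin.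
rewrite -[_ *: _]addr0; apply: dual_variables_lin (dual_variables0).
exact: dual_variables_coord.
Qed.

Lemma coord_variables_dual : M `<=` L.
Proof. by move=> _ [n [a [s ->]]]; exact: coord_comb_dual. Qed.

Lemma coord_variables_coord t : M (X_ t).
Proof.
by exists 1%N, (fun=> 1), (fun=> t); rewrite /coord_comb big_ord1 scale1r.
Qed.

Lemma coord_variables0 : M 0.
Proof.
(* [T] may be empty, so the empty family of indices is obtained from the absurdity of ['I_0]. *)
exists 0%N, (fun=> 0), (fun i : 'I_0 => False_rect T (notF (ltn_ord i))).
by rewrite /coord_comb big_ord0.
Qed.

Lemma coord_variables_lin (a : R) Y Z : M Y -> M Z -> M (a *: Y + Z).
Proof.
move=> [n [b [s ->]]] [m [c [t ->]]].
exists (n + m)%N, (fun i => match fintype.split i with inl j => a * b j | inr k => c k end),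
  (fun i => match fintype.split i with inl j => s j | inr k => t k end).
rewrite /coord_comb big_split_ord /= scaler_sumr; congr (_ + _).
  by apply: eq_bigr => j _; rewrite (unsplitK (inl j)) scalerA.
by apply: eq_bigr => k _; rewrite (unsplitK (inr k)).
Qed.

Let L_lin := dual_variables_lin.

Lemma dual_moment_lin (a : R) Y Z U : L Y -> L Z -> L U ->
  ip (a *: Y + Z) U = a * ip Y U + ip Z U.
Proof.
by move=> LY LZ LU; apply: mixed_moment_lin; exact: dual_variables_sqr.
Qed.

Let ip_linL := dual_moment_lin.

Lemma dual_moment_cauchy_schwarz Y Z : L Y -> L Z -> ip Y Z ^+ 2 <= ip Y Y * ip Z Z.
Proof.
exact: (ip_cauchy_schwarz L_lin (@mixed_momentC _ _ _ P) ip_linL (@mixed_moment_ge0 _ _ _ P)).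
Qed.

Lemma pettis_mean_dual (f : dual_space V) Y : L Y -> f (S Y) = ip (f \o W) Y.
Proof. by move=> /dual_variables_sqr; exact: pettis_meanP. Qed.

Lemma pettis_mean_lin (a : R) Y Z : L Y -> L Z -> S (a *: Y + Z) = a *: S Y + S Z.
Proof.
move=> LY LZ; apply: coord_inj => t; rewrite linearP !pettis_mean_dual//; last exact: L_lin.
rewrite mixed_momentC ip_linL//; last exact: dual_variables_coord.
by rewrite (mixed_momentC _ Y) (mixed_momentC _ Z).
Qed.

Lemma pettis_meanB Y Z : L Y -> L Z -> S (Y - Z) = S Y - S Z.
Proof.
by move=> LY LZ; rewrite addrC -scaleN1r pettis_mean_lin// scaleN1r addrC.
Qed.

(** With [Z = f(W)] the moment is [f (S Y)]. This makes the inner products on both RKHS independent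
    of the chosen representatives. *)
Lemma eq_pettis_mean Y Y' Z : L Y -> L Y' -> L Z -> S Y = S Y' -> ip Y Z = ip Y' Z.
Proof.
move=> LY LY' [f ->] SY.
by rewrite mixed_momentC -pettis_mean_dual// SY pettis_mean_dual// mixed_momentC.
Qed.

(** Each coordinate of [S Y] is a moment of [Y] with some [X_ t]; Cauchy-Schwarz applies, the second
    moments of the [X_ t] being uniformly bounded by [dual_moment_le] with [l = 1]. *)
Lemma pettis_mean_bounded : exists2 C : R, 0 < C &
  forall Y, L Y -> `|S Y| ^+ 2 <= C * ip Y Y.
Proof.
have [C C0 hC] := dual_moment_le Wgauss.
exists (C + 1) => [|Y LY]; first lra.
have CY : 0 <= (C + 1) * ip Y Y.
  by apply: mulr_ge0; [lra | exact: mixed_moment_ge0].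
rewrite -(sqr_sqrtr CY) ler_pXn2r ?nnegrE ?sqrtr_ge0//.
apply: norm_le_coord => [|t]; first exact: sqrtr_ge0.
rewrite -(ler_pXn2r (_ : (0 < 2)%N)) ?nnegrE ?sqrtr_ge0// sqr_sqrtr//.
rewrite real_normK ?num_real// pettis_mean_dual//.
apply: (le_trans (dual_moment_cauchy_schwarz (dual_variables_coord t) LY)).
rewrite ler_wpM2r ?mixed_moment_ge0//.
have [//||_] := hC (coord_proj B t) 1; first by move=> x; rewrite mul1r le_norm_coord.
by rewrite expr1n mulr1; lra.
Qed.

End dual_variables.

Section coord_variables_density.
Variables (R : realType) (T : Type) (B : submodClosed (linfty R T)).
Local Notation V := (subnormed B).
Hypotheses (Vcomplete : is_complete V) (Vseparable : is_separable V).
Context {d : measure_display} {Omega : measurableType d}.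
Variables (P : probability Omega R) (W : {RV P >-> borel V}).
Hypothesis Wgauss : gaussian0 W.

Local Notation ip := (mixed_moment P).
Local Notation S := (pettis_mean W).
Local Notation X_ t := (coord_proj B t \o W : Omega -> R^o).
Local Notation L := (dual_variables W).
Local Notation M := (coord_variables W).

Let L_lin := @dual_variables_lin R T B d Omega P W.

Let ip_linL := @dual_moment_lin R T B d Omega P W Wgauss.

Let LB := @dual_variablesB R T B d Omega P W.
Let ML := @coord_variables_dual R T B d Omega P W.

(** The Cauchy property for the seminorm of [ip], phrased with squares; [dot_cauchyP] translates it
    to [dot_cauchy]. *)
Definition moment_cauchy (Y : nat -> Omega -> R^o) : Prop :=
  forall e : R, 0 < e -> \forall m & n \near \oo, ip (Y m - Y n) (Y m - Y n) < e.

Lemma pettis_mean_cauchy (Y : nat -> Omega -> R^o) :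
  (forall n, L (Y n)) -> moment_cauchy Y -> exists x : V, S (Y n) @[n --> \oo] --> x.
Proof.
move=> LY cY; apply: complete_sequence => // e e0.
have [C C0 hC] := pettis_mean_bounded Vcomplete Vseparable Wgauss.
have eC : 0 < e ^+ 2 / C by rewrite divr_gt0// exprn_gt0.
apply: filterS (cY _ eC) => -[m n] /= mn.
rewrite -(ltr_pXn2r (_ : (0 < 2)%N)) ?nnegrE ?(ltW e0)//.
rewrite -pettis_meanB// (le_lt_trans (hC _ (LB (LY m) (LY n))))//.
by rewrite mulrC -ltr_pdivlMr.
Qed.

Lemma ler_sqr_small (a c : R) : 0 <= c -> a ^+ 2 <= c ^+ 2 -> `|a| <= c.
Proof.
move=> c0 ac; rewrite -(ler_pXn2r (_ : (0 < 2)%N)) ?nnegrE//.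
by rewrite real_normK ?num_real.
Qed.

Lemma cvg_sqr0 (a : nat -> R) (c : R) :
  (forall n, a n ^+ 2 <= n.+1%:R^-1 * c) -> a n @[n --> \oo] --> 0.
Proof.
move=> ha; have c0 : 0 <= c.
  by have := ha 0%N; rewrite invr1 mul1r; apply: le_trans; exact: sqr_ge0.
apply/cvgrPdist_le => e e0.
have ec : 0 < e ^+ 2 / (c + 1) by rewrite divr_gt0 ?exprn_gt0 ?ltr_wpDl.
near=> n; rewrite sub0r normrN; apply: ler_sqr_small; first exact: ltW.
apply: (le_trans (ha n)); apply: (@le_trans _ _ (n.+1%:R^-1 * (c + 1))).
  by rewrite ler_wpM2l// lerDl.
rewrite -ler_pdivlMr ?ltr_wpDl// ltW//; near: n.
exact: near_infty_natSinv_lt (PosNum ec).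
Unshelve. all: by end_near. Qed.

(* If [Z n] are the residuals of almost optimal approximations of [Y] by
   coordinate variables, then [S (Z n)] converges to an element of [V] all of
   whose coordinates vanish; since [Y] is [f \o W], its moments with [Z n] tend
   to [f 0 = 0], and so do the second moments of [Z n]. *)
Lemma coord_variables_dense Y (e : R) : L Y -> 0 < e ->
  exists2 Z, M Z & ip (Y - Z) (Y - Z) < e.
Proof.
move=> LY e0.
have [y [My yC yb yo]] := near_projection L_lin (@mixed_momentC _ _ _ P) ip_linL
  (@mixed_moment_ge0 _ _ _ P) (coord_variables0 W) (@coord_variables_lin _ _ _ _ _ _ W) ML LY.
pose Z n := Y - y n; have LZ n : L (Z n) by apply: LB => //; exact: ML.
have ZZ m n : Z m - Z n = y n - y m by rewrite /Z opprB addrC addrA subrK.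
have cZ : moment_cauchy Z.
  move=> r r0; have r5 : 0 < r / 5 by rewrite divr_gt0.
  near=> m n; rewrite ZZ; apply: (le_lt_trans (yC n m)).
  have hm : m.+1%:R^-1 < r / 5 by near: m; exact: near_infty_natSinv_lt (PosNum r5).
  have hn : n.+1%:R^-1 < r / 5 by near: n; exact: near_infty_natSinv_lt (PosNum r5).
  by set a := n.+1%:R^-1 in hn *; set b := m.+1%:R^-1 in hm *; lra.
have [v Zv] := pettis_mean_cauchy LZ cZ.
have fZv (f : dual_space V) : ip (f \o W) (Z n) @[n --> \oo] --> (f v : R).
  have -> : (fun n => ip (f \o W) (Z n)) = (fun n => f (S (Z n)) : R).
    by apply/funext => n; rewrite pettis_mean_dual.
  exact: (continuous_cvg _ (@dual_continuous _ _ f v) Zv).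
have v0 : v = 0.
  apply: coord_inj => t; rewrite linear0.
  have t0 : ip (X_ t) (Z n) @[n --> \oo] --> 0.
    have -> : (fun n => ip (X_ t) (Z n)) = (fun n => ip (Z n) (X_ t)).
      by apply/funext => n; rewrite mixed_momentC.
    by apply: cvg_sqr0 => n; apply: yo; exact: coord_variables_coord.
  exact: (cvg_unique _ (fZv (coord_proj B t)) t0).
have [f Yf] := LY.
have ipY0 : ip Y (Z n) @[n --> \oo] --> 0.
  by have := fZv f; rewrite v0 linear0 -Yf.
have ipy0 : ip (Z n) (y n) @[n --> \oo] --> 0.
  (* Since [y n = Y - Z n] and [ip (Z n) (Z n) <= ip Y Y + 1], the parallelogram law gives
     [ip (y n) (y n) <= 4 * ip Y Y + 2]; the last unit is the one in [near_projection]. *)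
  apply: (@cvg_sqr0 _ (4 * ip Y Y + 3)) => n; apply: (le_trans (yo n _ (My n))).
  rewrite ler_wpM2l//.
  have yYZ : y n = (-1) *: Z n + Y by rewrite scaleN1r opprB subrK.
  have := yb n; rewrite -/(Z n) => Zb.
  have : 0 <= ip (1 *: Z n + Y) (1 *: Z n + Y) by exact: mixed_moment_ge0.
  have n1 : n.+1%:R^-1 <= 1 :> R by rewrite invf_le1// ler1n.
  rewrite yYZ !(ipDZ L_lin (@mixed_momentC _ _ _ P) ip_linL)//.
  set a := ip (Z n) (Z n) in Zb *; set b := ip (Z n) Y; set c := ip Y Y in Zb *.
  by set r := n.+1%:R^-1 in Zb n1; lra.
have : ip (Z n) (Z n) @[n --> \oo] --> 0.
  have -> : (fun n => ip (Z n) (Z n)) = (fun n => ip Y (Z n) - ip (Z n) (y n)).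
    apply/funext => n; rewrite (mixed_momentC P (Z n) (y n)).
    rewrite {1}/Z addrC -scaleN1r ip_linL//; last exact: ML.
    by rewrite mulN1r addrC.
  have h : ip Y (Z n) - ip (Z n) (y n) @[n --> \oo] --> (0 - 0 : R) by exact: cvgB.
  by rewrite subr0 in h; exact: h.
move=> /cvgrPdist_lt /(_ _ e0) [N _ /(_ N (leqnn N))] /=.
rewrite sub0r normrN => h; exists (y N) => //.
exact: le_lt_trans (ler_norm _) h.
Unshelve. all: by end_near. Qed.

End coord_variables_density.

(** * Cauchy sequences and their representatives *)

Section moment_sequences.
Variables (R : realType) (T : Type) (B : submodClosed (linfty R T)).
Local Notation V := (subnormed B).
Hypotheses (Vcomplete : is_complete V) (Vseparable : is_separable V).
Context {d : measure_display} {Omega : measurableType d}.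
Variables (P : probability Omega R) (W : {RV P >-> borel V}).
Hypothesis Wgauss : gaussian0 W.

Local Notation ip := (mixed_moment P).
Local Notation S := (pettis_mean W).
Local Notation L := (dual_variables W).
Local Notation M := (coord_variables W).

Let LB := @dual_variablesB R T B d Omega P W.
Let ML := @coord_variables_dual R T B d Omega P W.

Let ip_linL := @dual_moment_lin R T B d Omega P W Wgauss.

Let ipB Y Z U : L Y -> L Z -> L U -> ip (Y - Z) U = ip Y U - ip Z U.
Proof.
by move=> LY LZ LU; rewrite addrC -scaleN1r ip_linL// mulN1r addrC.
Qed.

(** The parallelogram law without the nonnegative square of [Z - Y]. *)
Lemma moment_add_le Y Z : L Y -> L Z -> ip (Y + Z) (Y + Z) <= 2 * ip Y Y + 2 * ip Z Z.
Proof.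
move=> LY LZ.
have := mixed_moment_ge0 P ((-1) *: Y + Z).
rewrite -{3 4}[Y]scale1r.
rewrite !(ipDZ (@dual_variables_lin _ _ _ _ _ _ W) (@mixed_momentC _ _ _ P) ip_linL)//; lra.
Qed.

Lemma moment_cauchyP (Y : nat -> Omega -> R^o) (e : R) : moment_cauchy P Y -> 0 < e ->
  exists N, forall m n, (N <= m)%N -> (N <= n)%N -> ip (Y m - Y n) (Y m - Y n) < e.
Proof.
move=> cY e0; have [[A1 A2] [/= [N1 _ hA] [N2 _ hB]] hAB] := cY e e0.
exists (maxn N1 N2) => m n; rewrite !geq_max => /andP[m1 _] /andP[_ n2].
by apply: (hAB (m, n)); split; [exact: hA | exact: hB].
Qed.

Lemma cauchyP_moment (Y : nat -> Omega -> R^o) :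
  (forall e : R, 0 < e -> exists N, forall m n, (N <= m)%N -> (N <= n)%N ->
    ip (Y m - Y n) (Y m - Y n) < e) -> moment_cauchy P Y.
Proof.
move=> hY e /hY[N hN]; exists ([set n | (N <= n)%N], [set n | (N <= n)%N]) => /=.
  by split; exists N.
by move=> [m n] /= [hm hn]; exact: hN.
Qed.

Lemma moment_cauchyB Y Z : (forall n, L (Y n)) -> (forall n, L (Z n)) ->
  moment_cauchy P Y -> moment_cauchy P Z -> moment_cauchy P (fun n => Y n - Z n).
Proof.
move=> LY LZ cY cZ; apply: cauchyP_moment => e e0.
have e4 : 0 < e / 4 by rewrite divr_gt0.
have [N1 h1] := moment_cauchyP cY e4; have [N2 h2] := moment_cauchyP cZ e4.
exists (maxn N1 N2) => m n; rewrite !geq_max => /andP[m1 m2] /andP[n1 n2].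
have -> : Y m - Z m - (Y n - Z n) = (Y m - Y n) + (Z n - Z m).
  by rewrite opprB addrACA [RHS]addrACA [- Z m + _]addrC.
apply: (le_lt_trans (moment_add_le (LB (LY m) (LY n)) (LB (LZ n) (LZ m)))).
by have := h1 m n m1 n1; have := h2 n m n2 m2; lra.
Qed.

Lemma moment_cvg0_cauchy (D : nat -> Omega -> R^o) : (forall n, L (D n)) ->
  ip (D n) (D n) @[n --> \oo] --> 0 -> moment_cauchy P D.
Proof.
move=> LD0 D0; apply: cauchyP_moment => e e0.
have e4 : 0 < e / 4 by rewrite divr_gt0.
have /cvgrPdist_lt/(_ _ e4)[N _ hN] := D0.
have small n : (N <= n)%N -> ip (D n) (D n) < e / 4.
  by move=> /hN /=; rewrite sub0r normrN ger0_norm ?mixed_moment_ge0.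
exists N => m n /small hm /small hn.
have hn' : ip ((-1) *: D n) ((-1) *: D n) = ip (D n) (D n).
  rewrite (ipZ (@dual_variables_lin _ _ _ _ _ _ W) (@mixed_momentC _ _ _ P) ip_linL)//.
  by rewrite sqrrN expr1n mul1r.
rewrite -scaleN1r; apply: (le_lt_trans (moment_add_le (LD0 m) _)).
  by rewrite -[_ *: _]addr0; apply: dual_variables_lin => //; exact: dual_variables0.
by rewrite hn'; lra.
Qed.

Lemma moment_cvg0_pettis_mean (D : nat -> Omega -> R^o) : (forall n, L (D n)) ->
  ip (D n) (D n) @[n --> \oo] --> 0 -> S (D n) @[n --> \oo] --> 0.
Proof.
move=> LD0 D0; have [C C0 hC] := pettis_mean_bounded Vcomplete Vseparable Wgauss.
apply/cvgrPdist_lt => e e0.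
have eC : 0 < e ^+ 2 / C by rewrite divr_gt0// exprn_gt0.
have /cvgrPdist_lt/(_ _ eC) := D0; apply: filterS => n.
rewrite !sub0r !normrN ger0_norm ?mixed_moment_ge0// => hn.
rewrite -(ltr_pXn2r (_ : (0 < 2)%N)) ?nnegrE ?(ltW e0)//.
by rewrite (le_lt_trans (hC _ (LD0 n)))// mulrC -ltr_pdivlMr.
Qed.

(** By density, [Z n] can be taken at squared distance below [n.+1%:R^-1] from [Y n]. The
    differences are null, which changes neither the Cauchy property nor the limit of the means. *)
Lemma coord_variables_approx (Y : nat -> Omega -> R^o) (h : V) :
  (forall n, L (Y n)) -> moment_cauchy P Y -> S (Y n) @[n --> \oo] --> h ->
  exists Z, [/\ forall n, M (Z n), moment_cauchy P Z & S (Z n) @[n --> \oo] --> h].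
Proof.
move=> LY cY Yh.
have n0 n : 0 < n.+1%:R^-1 :> R by rewrite invr_gt0.
have eZ n : exists Z, M Z /\ ip (Y n - Z) (Y n - Z) < n.+1%:R^-1.
  have [Z MZ YZ] := coord_variables_dense Vcomplete Vseparable Wgauss (LY n) (n0 n).
  by exists Z.
have [Z hZ] := choice eZ.
have MZ n : M (Z n) by case: (hZ n).
have LZ n : L (Z n) by exact: ML.
pose D n := Y n - Z n; have LD0 n : L (D n) by exact: LB.
have D0 : ip (D n) (D n) @[n --> \oo] --> 0.
  apply/cvgrPdist_lt => e e0; near=> n.
  rewrite sub0r normrN ger0_norm ?mixed_moment_ge0//.
  apply: lt_trans (hZ n).2 _; near: n.
  exact: near_infty_natSinv_lt (PosNum e0).
have ZE n : Z n = Y n - D n by rewrite /D opprB addrC subrK.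
exists Z; split => //.
  by rewrite (funext ZE); apply: moment_cauchyB => //; exact: moment_cvg0_cauchy.
have -> : (fun n => S (Z n)) = (fun n => S (Y n) - S (D n)).
  by apply/funext => n; rewrite ZE pettis_meanB.
by rewrite -[h]subr0; apply: cvgB => //; exact: moment_cvg0_pettis_mean.
Unshelve. all: by end_near. Qed.

Lemma moment_cauchy_bounded (Y : nat -> Omega -> R^o) : (forall n, L (Y n)) ->
  moment_cauchy P Y -> exists2 K : R, 0 < K &
  exists N, forall n, (N <= n)%N -> ip (Y n) (Y n) <= K.
Proof.
move=> LY cY; have [N hN] := moment_cauchyP cY ltr01.
exists (2 + 2 * ip (Y N) (Y N)) => [|]; first by have := mixed_moment_ge0 P (Y N); lra.
exists N => n Nn; rewrite -[in leLHS](subrK (Y N) (Y n)).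
apply: (le_trans (moment_add_le (LB (LY n) (LY N)) (LY N))).
by have := hN n N Nn (leqnn N); lra.
Qed.

Lemma moment_prod_lt Y Z (e K : R) : L Y -> L Z -> 0 < e -> 0 < K ->
  ip Y Y < e ^+ 2 / K -> ip Z Z <= K -> `|ip Y Z| < e.
Proof.
move=> LY LZ e0 K0 hY hZ.
rewrite -(ltr_pXn2r (_ : (0 < 2)%N)) ?nnegrE ?(ltW e0)// real_normK ?num_real//.
rewrite (le_lt_trans (dual_moment_cauchy_schwarz Wgauss LY LZ))//.
rewrite (le_lt_trans (ler_wpM2l (mixed_moment_ge0 P Y) hZ))//.
by rewrite -ltr_pdivlMr.
Qed.

Lemma moment_prod_cvg0 (D Y : nat -> Omega -> R^o) : (forall n, L (D n)) ->
  (forall n, L (Y n)) -> ip (D n) (D n) @[n --> \oo] --> 0 -> moment_cauchy P Y ->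
  ip (D n) (Y n) @[n --> \oo] --> 0.
Proof.
move=> LD0 LY D0 cY; have [K K0 [N hN]] := moment_cauchy_bounded LY cY.
apply/cvgrPdist_lt => e e0.
have eK : 0 < e ^+ 2 / K by rewrite divr_gt0// exprn_gt0.
have /cvgrPdist_lt/(_ _ eK) D0' := D0.
near=> n; rewrite sub0r normrN; apply: (moment_prod_lt (K := K)) => //.
  have : `|0 - ip (D n) (D n)| < e ^+ 2 / K.
    by near: n; exact: D0'.
  by rewrite sub0r normrN ger0_norm ?mixed_moment_ge0.
by apply: hN; near: n; exact: nbhs_infty_ge.
Unshelve. all: by end_near. Qed.

(* A Cauchy sequence whose means tend to 0 is null: this is the injectivity of
   the identification of the completion with a subset of [V]. *)
Lemma pettis_mean_cvg0 (D : nat -> Omega -> R^o) : (forall n, L (D n)) ->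
  moment_cauchy P D -> S (D n) @[n --> \oo] --> 0 -> ip (D n) (D n) @[n --> \oo] --> 0.
Proof.
move=> LD0 cD SD0; have [K K0 [N0 hN0]] := moment_cauchy_bounded LD0 cD.
apply/cvgrPdist_lt => e e0; have e2 : 0 < e / 2 by rewrite divr_gt0.
have eK : 0 < (e / 2) ^+ 2 / K by rewrite divr_gt0// exprn_gt0.
have [N hN] := moment_cauchyP cD eK.
have [f fN] := LD0 N.
have fD0 : (f (S (D n)) : R) @[n --> \oo] --> 0.
  rewrite -[X in _ --> X](linear0 f).
  exact: (continuous_cvg _ (@dual_continuous _ _ f 0) SD0).
have /cvgrPdist_lt/(_ _ e2) fD0' := fD0.
near=> n; rewrite sub0r normrN.
(* The fixed term [D N] is some [f(W)], so its moment with [D n] is [f (S (D n))], which tends to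
   [f 0 = 0]; the remainder is small by the Cauchy property and boundedness. *)
have -> : ip (D n) (D n) = ip (D n - D N) (D n) + f (S (D n)).
  by rewrite pettis_mean_dual// -fN ipB// subrK.
rewrite (le_lt_trans (ler_normD _ _))// (splitr e) ltrD//.
  apply: (moment_prod_lt (K := K)) => //; first exact: LB.
    by apply: hN => //; near: n; exact: nbhs_infty_ge.
  by apply: hN0; near: n; exact: nbhs_infty_ge.
have : `|0 - f (S (D n))| < e / 2 by near: n; exact: fD0'.
by rewrite sub0r normrN.
Unshelve. all: by end_near. Qed.

(** Provides the limit that defines the inner product of the completion: products of bounded Cauchy
    sequences are Cauchy by bilinearity and Cauchy-Schwarz. *)
Lemma moment_prod_cvg (Y Z : nat -> Omega -> R^o) : (forall n, L (Y n)) ->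
  (forall n, L (Z n)) -> moment_cauchy P Y -> moment_cauchy P Z ->
  exists r : R, ip (Y n) (Z n) @[n --> \oo] --> r.
Proof.
move=> LY LZ cY cZ; have [K K0 [N1 hN1]] := moment_cauchy_bounded LY cY.
have [K' K'0 [N2 hN2]] := moment_cauchy_bounded LZ cZ.
suff cYZ : cauchy (ip (Y n) (Z n) @[n --> \oo]).
  by move/cauchy_cvgP : cYZ => cv; exists (lim (ip (Y n) (Z n) @[n --> \oo])).
apply/cauchy_ballP => e e0; rewrite near_map2.
have e2 : 0 < e / 2 by rewrite divr_gt0.
have eK : 0 < (e / 2) ^+ 2 / K by rewrite divr_gt0// exprn_gt0.
have eK' : 0 < (e / 2) ^+ 2 / K' by rewrite divr_gt0// exprn_gt0.
have [N3 hN3] := moment_cauchyP cY eK'; have [N4 hN4] := moment_cauchyP cZ eK.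
pose N := maxn (maxn N1 N2) (maxn N3 N4).
exists ([set n | (N <= n)%N], [set n | (N <= n)%N]); first by split; exists N.
move=> [m n] /= []; rewrite !geq_max => /andP[/andP[m1 m2] /andP[m3 m4]].
move=> /andP[/andP[n1 n2] /andP[n3 n4]]; rewrite -ball_normE /=.
have -> : ip (Y m) (Z m) - ip (Y n) (Z n) =
    ip (Y m - Y n) (Z m) + ip (Z m - Z n) (Y n).
  by rewrite !ipB// !(mixed_momentC P (Z _) (Y _)); ring.
rewrite (le_lt_trans (ler_normD _ _))// (splitr e) ltrD//.
  apply: (moment_prod_lt (K := K')) => //; [exact: LB|exact: hN3|exact: hN2].
apply: (moment_prod_lt (K := K)) => //; [exact: LB|exact: hN4|exact: hN1].
Qed.

(** Two sequences that represent the same element differ by a null sequence, by [pettis_mean_cvg0],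
    and null sequences do not affect limits of moments. So [completion_dot] is well defined. *)
Lemma moment_prod_unique (h g : V) (r r' : R) (Y Z Y' Z' : nat -> Omega -> R^o) :
  (forall n, L (Y n)) -> (forall n, L (Z n)) ->
  (forall n, L (Y' n)) -> (forall n, L (Z' n)) ->
  moment_cauchy P Y -> moment_cauchy P Z -> moment_cauchy P Y' -> moment_cauchy P Z' ->
  S (Y n) @[n --> \oo] --> h -> S (Z n) @[n --> \oo] --> g ->
  S (Y' n) @[n --> \oo] --> h -> S (Z' n) @[n --> \oo] --> g ->
  ip (Y n) (Z n) @[n --> \oo] --> r -> ip (Y' n) (Z' n) @[n --> \oo] --> r' -> r = r'.
Proof.
move=> LY LZ LY' LZ' cY cZ cY' cZ' Yh Zg Y'h Z'g Yr Y'r'.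
have null U U' (k : V) : (forall n, L (U n)) -> (forall n, L (U' n)) ->
    moment_cauchy P U -> moment_cauchy P U' -> S (U n) @[n --> \oo] --> k ->
    S (U' n) @[n --> \oo] --> k ->
    ip (U n - U' n) (U n - U' n) @[n --> \oo] --> 0.
  move=> LU LU' cU cU' Uk U'k.
  apply: (@pettis_mean_cvg0 (fun n => U n - U' n)) => [n||].
  - exact: LB.
  - exact: moment_cauchyB.
  have -> : (fun n => S (U n - U' n)) = (fun n => S (U n) - S (U' n)).
    by apply/funext => n; rewrite pettis_meanB.
  by rewrite -[0](subrr k); exact: cvgB.
have D1 : ip (Y n - Y' n) (Z n) @[n --> \oo] --> 0.
  by apply: moment_prod_cvg0 => // [n|]; [exact: LB | exact: (null _ _ h)].
have D2 : ip (Z n - Z' n) (Y' n) @[n --> \oo] --> 0.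
  by apply: moment_prod_cvg0 => // [n|]; [exact: LB | exact: (null _ _ g)].
have E : (fun n => ip (Y n) (Z n)) =
    (fun n => ip (Y n - Y' n) (Z n) + ip (Z n - Z' n) (Y' n) + ip (Y' n) (Z' n)).
  by apply/funext => n; rewrite !ipB// !(mixed_momentC P (Z' _) (Y' _))
    (mixed_momentC P (Z _) (Y' _)); ring.
have Yr' : ip (Y n) (Z n) @[n --> \oo] --> (0 + 0 + r' : R).
  by rewrite E; apply: cvgD => //; exact: cvgD.
by rewrite !add0r in Yr'; exact: (cvg_unique _ Yr Yr').
Qed.

End moment_sequences.

Lemma dot_cauchyP (R : realType) (E : lmodType R) (dot : E -> E -> R) (u : nat -> E)
    (q : nat -> nat -> R) : (forall m n, dot (u m - u n) (u m - u n) = q m n) ->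
  (forall m n, 0 <= q m n) ->
  dot_cauchy dot u <-> forall e : R, 0 < e -> \forall m & n \near \oo, q m n < e.
Proof.
move=> uq q0; split=> cu e e0.
  have se : 0 < Num.sqrt e by rewrite sqrtr_gt0.
  apply: filterS (cu _ se) => -[m n] /=; rewrite /dot_norm uq => h.
  by rewrite -(sqr_sqrtr (q0 m n)) -(sqr_sqrtr (ltW e0)) ltr_pXn2r ?nnegrE ?sqrtr_ge0.
have e2 : 0 < e ^+ 2 by rewrite exprn_gt0.
apply: filterS (cu _ e2) => -[m n] /=; rewrite /dot_norm uq => h.
by rewrite -(ltr_pXn2r (_ : (0 < 2)%N)) ?nnegrE ?sqrtr_ge0 ?(ltW e0)// sqr_sqrtr.
Qed.

(** * Both RKHS described by Cauchy sequences of random variables *)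

Section rkhs_representatives.
Variables (R : realType) (T : Type) (B : submodClosed (linfty R T)).
Local Notation V := (subnormed B).
Hypotheses (Vcomplete : is_complete V) (Vseparable : is_separable V).
Context {d : measure_display} {Omega : measurableType d}.
Variables (P : probability Omega R) (W : {RV P >-> borel V}).
Hypothesis Wgauss : gaussian0 W.

Local Notation ip := (mixed_moment P).
Local Notation S := (pettis_mean W).
Local Notation L := (dual_variables W).
Local Notation M := (coord_variables W).
Local Notation X := (fun t w => coord_proj B t (W w)).
Local Notation X_ t := (coord_proj B t \o W : Omega -> R^o).

Let LB := @dual_variablesB R T B d Omega P W.
Let ML := @coord_variables_dual R T B d Omega P W.
Let LX := @dual_variables_coord R T B d Omega P W.

Lemma to_fun_inj : injective (@to_fun R T B).
Proof. by move=> x y xy; apply: coord_inj => t; have := congr1 (@^~ t) xy. Qed.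

Lemma covKE s t : covK P X s t = ip (X_ s) (X_ t).
Proof. by rewrite /covK unlock. Qed.

Lemma to_fun_pettis_mean Y t : L Y -> to_fun (S Y) t = ip (X_ t) Y.
Proof. by move=> LY; rewrite -(pettis_mean_dual Vcomplete Vseparable Wgauss _ LY). Qed.

Lemma covK_pettis_mean t : covK P X t = to_fun (S (X_ t)).
Proof.
by apply/funext => s; rewrite covKE to_fun_pettis_mean// mixed_momentC.
Qed.

Lemma coord_comb_momentl n (a : 'I_n -> R) (s : 'I_n -> T) Z : L Z ->
  ip (coord_comb W a s) Z = \sum_(i < n) a i * ip (X_ (s i)) Z.
Proof.
move=> LZ; have X2 i : square_integrable P (X_ (s i)).
  by apply: dual_variables_sqr; [exact: Wgauss | exact: LX].
have Z2 : square_integrable P Z by exact: dual_variables_sqr Wgauss _ LZ.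
exact: (mixed_moment_sum a X2 Z2).2.
Qed.

(** Identifies the span of the kernel functions with the image of [coord_variables] under [S]. *)
Lemma kernel_combE n (a : 'I_n -> R) (s : 'I_n -> T) :
  kernel_comb P X a s = to_fun (S (coord_comb W a s)).
Proof.
apply/funext => t; rewrite (to_fun_pettis_mean _ (coord_comb_dual W a s)).
rewrite mixed_momentC (coord_comb_momentl _ _ (LX t)).
by apply: eq_bigr => i _; rewrite covKE.
Qed.

Lemma coord_comb_moment m (a : 'I_m -> R) s n (b : 'I_n -> R) t :
  ip (coord_comb W a s) (coord_comb W b t) =
  \sum_(i < m) \sum_(j < n) a i * b j * covK P X (s i) (t j).
Proof.
rewrite (coord_comb_momentl _ _ (coord_comb_dual W b t)).
apply: eq_bigr => i _; rewrite mixed_momentC (coord_comb_momentl _ _ (LX (s i))).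
by rewrite mulr_sumr; apply: eq_bigr => j _; rewrite covKE mixed_momentC mulrA.
Qed.

(** Different combinations giving the same function have the same mean in [V], hence the same
    moments by [eq_pettis_mean]; so the set under [xget] is a singleton. *)
Lemma kernel_dotE Y Z : M Y -> M Z -> kernel_dot P X (to_fun (S Y)) (to_fun (S Z)) = ip Y Z.
Proof.
move=> MY MZ; have [LY LZ] := (ML MY, ML MZ).
apply: xget_unique.
  move: MY MZ => [m [a [s ->]]] [n [b [t ->]]].
  by exists m, a, s, n, b, t; rewrite !kernel_combE coord_comb_moment.
move=> r [m [a [s [n [b [t [SY SZ ->]]]]]]].
rewrite -coord_comb_moment; move: SY SZ; rewrite !kernel_combE => /to_fun_inj SY /to_fun_inj SZ.
have La := coord_comb_dual W a s; have Lb := coord_comb_dual W b t.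
rewrite -(eq_pettis_mean Vcomplete Vseparable Wgauss LY La Lb SY).
rewrite mixed_momentC -(eq_pettis_mean Vcomplete Vseparable Wgauss LZ Lb LY SZ).
by rewrite mixed_momentC.
Qed.

Lemma pettis_dotE Y Z : L Y -> L Z -> pettis_dot W (S Y) (S Z) = ip Y Z.
Proof.
move=> LY LZ; have exp U U' : L U -> L U' -> ('E_P[fun w => (U w * U' w)%R] = (ip U U')%:E)%E.
  by move=> LU LU'; apply: expectation_mul; exact: dual_variables_sqr.
apply: xget_unique.
  by move: (LY) (LZ) (exp _ _ LY LZ) => [f ->] [g ->] fg; exists f, g.
move=> r [f [g [SY SZ fgr]]].
have Lf : L (f \o W) by exists f.
have Lg : L (g \o W) by exists g.
have := exp _ _ Lf Lg; rewrite fgr => -[->].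
rewrite (eq_pettis_mean Vcomplete Vseparable Wgauss Lf LY Lg SY).
rewrite mixed_momentC (eq_pettis_mean Vcomplete Vseparable Wgauss Lg LZ LY SZ).
by rewrite mixed_momentC.
Qed.

(** Choosing a functional for each term lifts a sequence in the range of [pettis] to variables
    [f(W)], and [pettis_dot] becomes their mixed moment. *)
Lemma pettis_represents u h :
  represents (range (pettis W)) (pettis_dot W) (fun u h => u @ \oo --> h) u h <->
  exists Y, [/\ forall n, L (Y n), moment_cauchy P Y, u = S \o Y & S (Y n) @[n --> \oo] --> h].
Proof.
have cE Y : (forall n, L (Y n)) -> dot_cauchy (pettis_dot W) (S \o Y) <-> moment_cauchy P Y.
  move=> LY; apply: dot_cauchyP => m n; last exact: mixed_moment_ge0.
  by rewrite /= -pettis_meanB// pettis_dotE//; exact: LB.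
split=> [[uS cu uh]|[Y [LY cY -> Yh]]].
  have /choice[f fu] : forall n, exists f, pettis W f = u n.
    by move=> n; have [f _ fu] := uS n; exists f.
  have uE : u = S \o (fun n => f n \o W) by apply/funext => n; rewrite -fu.
  rewrite uE in cu uh *; have LY n : L (f n \o W) by exists (f n).
  by exists (fun n => f n \o W); split => //; apply/cE.
split => //; last exact/cE.
by move=> n; have [f Yf] := LY n; exists f => //; rewrite /= Yf.
Qed.

(** The reproducing formula identifies limits pointwise only. The means of a Cauchy sequence
    converge in [V] anyway, and the pointwise limit must be the function of that norm limit. *)
Lemma kernel_represents u f :
  represents (kernel_span P X) (kernel_dot P X) (reproduces P X) u f <->
  exists Y, [/\ forall n, M (Y n), moment_cauchy P Y,
    u = (fun n => to_fun (S (Y n))) &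
    exists2 h : V, S (Y n) @[n --> \oo] --> h & f = to_fun h].
Proof.
have spanE g : kernel_span P X g <-> exists2 Y, M Y & g = to_fun (S Y).
  split=> [[n [a [s ->]]]|[_ [n [a [s ->]]] ->]].
    by exists (coord_comb W a s); [exists n, a, s | rewrite kernel_combE].
  by exists n, a, s; rewrite kernel_combE.
have cE Y : (forall n, M (Y n)) ->
    dot_cauchy (kernel_dot P X) (fun n => to_fun (S (Y n))) <-> moment_cauchy P Y.
  move=> MY; apply: dot_cauchyP => m n; last exact: mixed_moment_ge0.
  have MYmn : M (Y m - Y n).
    by rewrite addrC -scaleN1r; exact: coord_variables_lin.
  rewrite -(kernel_dotE MYmn MYmn) pettis_meanB//; exact: ML.
(* On the span, the inner product with [K(t, .)] is evaluation at [t]. *)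
have pointwise Y t : (forall n, M (Y n)) ->
    (fun n => kernel_dot P X (to_fun (S (Y n))) (covK P X t)) =
    (fun n => coord_proj B t (S (Y n)) : R).
  move=> MY; apply/funext => n; rewrite covK_pettis_mean kernel_dotE//; last first.
    exact: coord_variables_coord.
  by rewrite mixed_momentC -to_fun_pettis_mean//; exact: ML.
have coordcvg Y h t : S (Y n) @[n --> \oo] --> h ->
    (coord_proj B t (S (Y n)) : R) @[n --> \oo] --> (to_fun h t : R).
  by move=> Yh; exact: (continuous_cvg _ (@dual_continuous _ _ (coord_proj B t) h) Yh).
split=> [[uS cu uf]|[Y [MY cY -> [h Yh ->]]]].
  have /choice[Y hY] : forall n, exists Y, M Y /\ u n = to_fun (S Y).
    by move=> n; have /spanE[Y MY uY] := uS n; exists Y.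
  have uE : u = (fun n => to_fun (S (Y n))) by apply/funext => n; rewrite (hY n).2.
  have MY n : M (Y n) := (hY n).1.
  rewrite uE in cu uf *; have /cE cY := cu.
  exists Y; split => //; first exact: cY.
  have [h Yh] := pettis_mean_cauchy Vcomplete Vseparable Wgauss (fun n => ML (MY n)) (cY MY).
  exists h => //; apply/funext => t; have := uf t; rewrite pointwise// => ft.
  exact: (cvg_unique _ ft (coordcvg _ _ t Yh)).
split; first by move=> n; apply/spanE; exists (Y n).
  exact/cE.
by move=> t; rewrite pointwise//; exact: coordcvg.
Qed.

(** Coordinate variables are dual variables, which gives one inclusion; the other replaces a
    representing sequence by coordinate variables through [coord_variables_approx]. *)
Lemma to_fun_banach_rkhs : @to_fun R T B @` banach_rkhs W = process_rkhs P X.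
Proof.
apply/seteqP; split=> [_ [h [u /pettis_represents[Y [LY cY _ Yh]]] <-]|f].
  have [Z [MZ cZ Zh]] := coord_variables_approx Vcomplete Vseparable Wgauss LY cY Yh.
  exists (fun n => to_fun (S (Z n))); apply/kernel_represents.
  by exists Z; split => //; exists h.
move=> [u /kernel_represents[Y [MY cY _ [h Yh ->]]]]; exists h => //.
exists (S \o Y); apply/pettis_represents; exists Y; split => // n; exact: ML.
Qed.

Lemma to_fun_banach_rkhs_dot (h g : V) : banach_rkhs W h -> banach_rkhs W g ->
  banach_rkhs_dot W h g = process_rkhs_dot P X (to_fun h) (to_fun g).
Proof.
move=> [u /pettis_represents[Y0 [LY0 cY0 _ Y0h]]] [v /pettis_represents[Z0 [LZ0 cZ0 _ Z0g]]].
have [Y [MY cY Yh]] := coord_variables_approx Vcomplete Vseparable Wgauss LY0 cY0 Y0h.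
have [Z [MZ cZ Zg]] := coord_variables_approx Vcomplete Vseparable Wgauss LZ0 cZ0 Z0g.
have LY n : L (Y n) := ML (MY n).
have LZ n : L (Z n) := ML (MZ n).
have [r YZr] := moment_prod_cvg Wgauss LY LZ cY cZ.
(* One pair of coordinate sequences represents [h] and [g] in both spaces, so both inner products
   equal the limit [r] of its moments. *)
transitivity r; [|symmetry]; apply: xget_unique.
- exists (S \o Y), (S \o Z); split.
  + by apply/pettis_represents; exists Y.
  + by apply/pettis_represents; exists Z.
  + have -> // : (fun n => pettis_dot W ((S \o Y) n) ((S \o Z) n)) = (fun n => ip (Y n) (Z n)).
    by apply/funext => n; rewrite /= pettis_dotE.
- move=> r' [u' [v' [/pettis_represents[Y' [LY' cY' -> Y'h]]
    /pettis_represents[Z' [LZ' cZ' -> Z'g]] Y'Z'r']]].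
  apply: (moment_prod_unique Vcomplete Vseparable Wgauss LY' LZ' LY LZ cY' cZ' cY cZ
    Y'h Z'g Yh Zg _ YZr).
  have <- // : (fun n => pettis_dot W ((S \o Y') n) ((S \o Z') n)) =
      (fun n => ip (Y' n) (Z' n)).
  by apply/funext => n; rewrite /= pettis_dotE.
- exists (fun n => to_fun (S (Y n))), (fun n => to_fun (S (Z n))); split.
  + by apply/kernel_represents; exists Y; split => //; exists h.
  + by apply/kernel_represents; exists Z; split => //; exists g.
  + have -> // : (fun n => kernel_dot P X (to_fun (S (Y n))) (to_fun (S (Z n)))) =
        (fun n => ip (Y n) (Z n)).
    by apply/funext => n; rewrite kernel_dotE.
move=> r' [u' [v' [/kernel_represents[Y' [MY' cY' -> [h' Y'h /to_fun_inj hh']]]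
  /kernel_represents[Z' [MZ' cZ' -> [g' Z'g /to_fun_inj gg']]] Y'Z'r']]].
rewrite -hh' -gg' in Y'h Z'g.
apply: (moment_prod_unique Vcomplete Vseparable Wgauss (fun n => ML (MY' n))
  (fun n => ML (MZ' n)) LY LZ cY' cZ' cY cZ Y'h Z'g Yh Zg _ YZr).
have <- // : (fun n => kernel_dot P X (to_fun (S (Y' n))) (to_fun (S (Z' n)))) =
    (fun n => ip (Y' n) (Z' n)).
by apply/funext => n; rewrite kernel_dotE.
Qed.

End rkhs_representatives.

Theorem theorem2p1 (R : realType) (d : measure_display)
    (Omega : measurableType d) (P : probability Omega R) (T : Type)
    (B : submodClosed (linfty R T))
    (Bcomplete : is_complete (subnormed B))
    (Bseparable : is_separable (subnormed B))
    (W : {RV P >-> borel (subnormed B)})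
    (Wgauss : gaussian0 W) :
  let X : T -> Omega -> R := fun t w => coord_proj B t (W w) in
  [/\ @to_fun R T B @` banach_rkhs W = process_rkhs P X,
      forall h g : subnormed B, banach_rkhs W h -> banach_rkhs W g ->
        banach_rkhs_dot W h g = process_rkhs_dot P X (to_fun h) (to_fun g)
    & forall t : T, to_fun (pettis W (coord_proj B t)) = covK P X t].
Proof.
move=> X; split.
- exact: to_fun_banach_rkhs.
- exact: to_fun_banach_rkhs_dot.
- by move=> t; rewrite covK_pettis_mean.
Qed.
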